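(* For all integers $N\ge 1$, $K\ge1$, $1\le A\le B\le C\le N$ other than $(N,K,A,B,C)\in\{(1,1,1,1,1),(2,1,1,1,2)\}$, \begin{align*} p_{N,K;A,B,C}&=[A=B=C]\sum_{a=1}^{A-1}\sum_{b=1}^{N-1}\sum_{c=A}^{N-1}p_{N-1,K-1;a,b,c} +[A=B<C]\sum_{a=1}^{C-2}\sum_{b=1}^{N-2}\sum_{c=A}^{N-2}p_{N-2,K-1;a,b,c}\\ &\quad+[A<B<C]\sum_{b=A}^{B-1}p_{N-1,K;A,b,C-1}, \end{align*} with initial conditions $p_{1,1;1,1,1}=p_{2,1;1,1,2}=1$. Moreover, the number of pop-stacked permutations of size $n$ with $k$ runs is $p_{n,k}=\sum_{a=1}^n\sum_{b=a}^n\sum_{c=b}^n p_{n,k;a,b,c}$, the number of pop-stacked permutations of size $n$ is $p_n=\sum_{k=1}^n p_{n,k}$, and $p_n$ can be computed with $\sim n^4/8$ time complexity and $\sim n^3/3$ memory complexity.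
   Context: Runs of a permutation are its maximal increasing strings of consecutive entries; falls are its maximal decreasing strings of consecutive entries. The flip $T$ reverses every fall in place; a permutation is pop-stacked if it lies in the image of $T$. For $n\ge1$ and $1\le a\le b\le c\le n$, $p_{n,k;a,b,c}$ is the number of pop-stacked permutations of size $n$ with exactly $k$ runs whose last run has smallest element $a$ and largest element $c$, and where $b$ is the second-largest element of the last run if $a<c$, and $b=a=c$ if $a=c$; $p_{n,k;a,b,c}=0$ whenever the indices are outside this range. $[\cdot]$ is the Iverson bracket (1 if the condition holds, 0 otherwise). *)

(* Defs.v *)
From HB Require Import structures.
From mathcomp Require Import all_boot all_order all_fingroup all_algebra.
Set Implicit Arguments.
Unset Strict Implicit.
Unset Printing Implicit Defensive.

(* The maximal strings of consecutive entries of s in which successive entries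
   are related by r, in order of appearance. *)
Fixpoint strings (r : rel nat) (s : seq nat) : seq (seq nat) :=
  if s isn't x :: s' then [::] else
  match strings r s' with
  | (y :: u) :: us =>
      if r x y then (x :: y :: u) :: us else [:: x] :: (y :: u) :: us
  | _ => [:: [:: x]]
  end.

Definition runs : seq nat -> seq (seq nat) := strings ltn.
Definition falls : seq nat -> seq (seq nat) := strings gtn.

Definition flip (w : seq nat) : seq nat := flatten [seq rev f | f <- falls w].

(* One-line notation, with letters 1, ..., n. *)
Definition word (n : nat) (s : 'S_n) : seq nat :=
  [seq (val (s i)).+1 | i <- enum 'I_n].

Definition pop_stacked (n : nat) (s : 'S_n) : bool :=
  [exists t : 'S_n, flip (word t) == word s].

Definition is_smallest (u : seq nat) (a : nat) : bool :=
  (a \in u) && all (fun x => a <= x) u.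
Definition is_largest (u : seq nat) (c : nat) : bool :=
  (c \in u) && all (fun x => x <= c) u.

Definition run_parameters (u : seq nat) (a b c : nat) : bool :=
  [&& is_smallest u a, is_largest u c
    & if a < c then is_largest (rem c u) b else b == a].

Definition popstacked_abc (n k a b c : nat) : nat :=
  if (1 <= n) && [&& 1 <= a, a <= b, b <= c & c <= n] then
    #|[set s : 'S_n | [&& pop_stacked s, size (runs (word s)) == k
                        & run_parameters (last [::] (runs (word s))) a b c]]|
  else 0.

Definition popstacked_runs (n k : nat) : nat :=
  #|[set s : 'S_n | pop_stacked s && (size (runs (word s)) == k)]|.

Definition popstacked (n : nat) : nat := #|[set s : 'S_n | pop_stacked s]|.

(* The machine model behind time and memory complexity: programs built from
   counted loops over memory cells holding natural numbers of arbitrary size.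
   A cell is an entry of a named array, and the only arithmetic on cell contents
   is addition. Loop bounds and array positions are affine expressions in the
   input n and the indices of the enclosing loops. They cannot depend on cell
   contents, so nothing can be computed outside the cells. *)

Inductive iexpr : Type :=
  | Ivar of nat (* de Bruijn: 0 is the innermost loop index, n comes last *)
  | Icst of int
  | Iadd of iexpr & iexpr
  | Isub of iexpr & iexpr.

Definition cell : Type := (nat * seq iexpr)%type.

Inductive expr : Type :=
  | Ecst of nat
  | Eread of cell
  | Eadd of expr & expr.

Inductive prog : Type :=
  | Assign of cell & expr
  | Compose of prog & prog
  | For of iexpr & iexpr & prog. (* both bounds included *)

Definition address : Type := (nat * seq int)%type.

Record state := State {
  mem : address -> nat;
  clock : nat;
  accessed : seq address }.

Fixpoint ieval (env : seq int) (e : iexpr) : int :=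
  match e with
  | Ivar i => nth 0%R env i
  | Icst z => z
  | Iadd e1 e2 => (ieval env e1 + ieval env e2)%R
  | Isub e1 e2 => (ieval env e1 - ieval env e2)%R
  end.

Definition locate (env : seq int) (x : cell) : address :=
  (x.1, [seq ieval env e | e <- x.2]).

Fixpoint eeval (env : seq int) (m : address -> nat) (e : expr) : nat :=
  match e with
  | Ecst k => k
  | Eread x => m (locate env x)
  | Eadd e1 e2 => eeval env m e1 + eeval env m e2
  end.

Fixpoint additions (e : expr) : nat :=
  if e is Eadd e1 e2 then (additions e1 + additions e2).+1 else 0.

Fixpoint reads (env : seq int) (e : expr) : seq address :=
  match e with
  | Ecst _ => [::]
  | Eread x => [:: locate env x]
  | Eadd e1 e2 => reads env e1 ++ reads env e2
  end.

Definition interval_seq (lo hi : int) : seq int :=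
  if (lo <= hi)%R then [seq (lo + Posz k)%R | k <- iota 0 (absz (hi - lo)%R).+1]
  else [::].

Definition tick (st : state) : state :=
  State (mem st) (clock st).+1 (accessed st).

(* One unit of time for each addition, each assignment and each loop
   iteration. *)
Fixpoint exec (p : prog) (env : seq int) (st : state) : state :=
  match p with
  | Assign x e =>
      let l := locate env x in
      let v := eeval env (mem st) e in
      State (fun l' => if l' == l then v else mem st l')
            (clock st + (additions e).+1)
            (l :: reads env e ++ accessed st)
  | Compose p1 p2 => exec p2 env (exec p1 env st)
  | For lo hi body =>
      foldl (fun st' i => exec body (i :: env) (tick st')) st
            (interval_seq (ieval env lo) (ieval env hi))
  end.

Definition final_state (p : prog) (n : nat) : state :=
  exec p [:: Posz n] (State (fun _ => 0) 0 [::]).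

Definition output (p : prog) (n : nat) : nat := mem (final_state p n) (0, [::]).
Definition time_cost (p : prog) (n : nat) : nat := clock (final_state p n).

(* The number of distinct cells read or written. *)
Definition memory_cost (p : prog) (n : nat) : nat :=
  size (undup (accessed (final_state p n))).

(* Main.v *)
(** A permutation is pop-stacked exactly when consecutive runs overlap, i.e.
    when the minimum of each run is smaller than the maximum of the next one:
    flipping turns each ascent between two falls into such an overlap, and
    reversing all runs of an overlapping permutation gives a preimage under the
    flip.  Every permutation of size n+1 is obtained from a unique permutation
    of size n by appending a letter and shifting the other ones, which extends
    the last run or opens a new one, and this yields the recurrence.

    Summed over k, the recurrence needs only the prefix sums
    Q_N(A,B,C) = sum_(A <= b <= B) p_(N;A,b,C), which satisfy
    Q_N(A,B,C) = Q_N(A,B-1,C) + Q_(N-1)(A,B-1,C-1) for A < B < C.  Each of the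
    about n^4/24 updates costs one loop iteration, one addition and one
    assignment.  Row (N,A) is kept in plane N-A, which row (N-1,A-1) no longer
    needs, so that about n^3/3 cells suffice. *)

Require Import Defs.
From mathcomp Require Import all_boot all_order all_fingroup all_algebra.
From mathcomp Require Import all_classical all_reals all_analysis.
From mathcomp Require Import zify ring lra.

Set Implicit Arguments.
Unset Strict Implicit.
Unset Printing Implicit Defensive.

Import Order.TTheory GRing.Theory Num.Theory numFieldNormedType.Exports.
Local Open Scope nat_scope.

(** * Runs, falls and pop-stacked permutations *)

(** Being pop-stacked is not inherited by prefixes: deleting the last letter C lowers the maximum of
    the last run, and the overlap with the run before it may be lost. That overlap depends on the
    last run only through its maximum. So a last run with at least three letters gives up its
    second-largest letter B and keeps C, which becomes C-1 after renaming; this is why b has to be a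
    parameter. A last run with two letters is deleted as a whole, which reaches back two sizes, and
    a last run with one letter loses that letter. In these two cases the preceding run becomes the
    last one; the descent bounds its largest entry from below, the overlap bounds its smallest entry
    from above, and b stays free. Such sums over a corner of the (a, c) plane fit in two-dimensional
    tables of negligible cost, so only the case of three or more letters determines the leading
    terms of time and memory. *)

Definition string_decomposition (r : rel nat) (us : seq (seq nat)) : bool :=
  all (fun u => (u != [::]) && sorted r u) us &&
  sorted (fun u v => ~~ r (last 0 u) (head 0 v)) us.

(** Maximality of the strings is a local condition at each junction, so a decomposition is
    determined by its concatenation. Runs and falls are identified below by exhibiting blocks and
    checking these conditions, without computing [strings]. *)
Lemma strings_flatten (r : rel nat) (us : seq (seq nat)) :
  string_decomposition r us -> strings r (flatten us) = us.
Proof.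
elim: us => [//|u us IH] /andP[/= /andP[/andP[u0 su] aus] sus].
have {}IH : strings r (flatten us) = us.
  by apply: IH; rewrite /string_decomposition aus (path_sorted sus).
case: u u0 su sus => [//|x u] _ /=.
elim: u x => [|y u IHu] x /=.
  rewrite IH => _ {IH}; case: us aus => [//|[|y v] us] //= _.
  by case/andP => /negbTE->.
case/andP=> rxy py sus; rewrite (IHu y py) ?rxy //.
by case: (us) sus.
Qed.

Lemma strings_decomposition (r : rel nat) (s : seq nat) :
  string_decomposition r (strings r s).
Proof.
elim: s => [//|x s] /=.
case: (strings r s) => [|[|y u] us] //=.
case: ifP => rxy; rewrite /string_decomposition /= ?rxy //=.
by case: us => [|v us].
Qed.

Lemma flatten_strings (r : rel nat) (s : seq nat) : flatten (strings r s) = s.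
Proof.
elim: s => [//|x s] /=; have := strings_decomposition r s.
case: (strings r s) => [_ <- //|[|y u] us] //= _ <-.
by case: ifP.
Qed.

Lemma strings_map (r : rel nat) (f : nat -> nat) (s : seq nat) :
  {mono f : x y / r x y} -> strings r (map f s) = map (map f) (strings r s).
Proof.
move=> fr; elim: s => [//|x s IH] /=; rewrite IH.
by case: (strings r s) => [|[|y u] us] //=; rewrite fr; case: ifP.
Qed.

Lemma strings_eq0 (r : rel nat) (s : seq nat) :
  (strings r s == [::]) = (s == [::]).
Proof. by case: s => [//|x s] /=; case: strings => [|[|y u] us] //=; case: ifP. Qed.

Lemma size_strings (r : rel nat) (s : seq nat) : size (strings r s) <= size s.
Proof.
elim: s => [//|x s] /=; case: strings => [|[|y u] us] //=.
by case: ifP => //= _; lia.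
Qed.

(** On increasing strings [head] is the minimum and [last] the maximum. *)
Definition overlap (u v : seq nat) : bool := head 0 u < last 0 v.

Lemma last_rev_head (u : seq nat) : last 0 (rev u) = head 0 u.
Proof. by case: u => [//|x u]; rewrite rev_cons last_rcons. Qed.

Lemma head_rev_last (u : seq nat) : head 0 (rev u) = last 0 u.
Proof. by rewrite -last_rev_head revK. Qed.

Lemma sorted_ltn_head_last (u : seq nat) : sorted ltn u -> head 0 u <= last 0 u.
Proof.
case: u => [//|x u] /=; elim: u x => [//|y u IH] x /= /andP[xy /IH].
by apply: leq_trans; apply: ltnW.
Qed.

(* The break between two falls f, g of w is an ascent last f < head g, and
   these two letters become the first letter of rev f and the last letter of
   rev g. *)
Lemma overlap_runs_flip (w : seq nat) :
  uniq w -> sorted overlap (runs (flip w)).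
Proof.
rewrite /flip -{1}(flatten_strings gtn w) -/falls.
have: string_decomposition gtn (falls w) by apply: strings_decomposition.
move: (falls w) => F dF uF.
(* The induction needs the extra conjunct: the first run reaches at least the first letter of the
   first fall. An ascent from an earlier fall into this one then yields an overlap with that run. *)
suff: sorted overlap (runs (flatten (map rev F))) /\
   (head 0 (head [::] F) <= last 0 (head [::] (runs (flatten (map rev F))))) by case.
elim: F dF uF => [//|f F IH] /andP[/= /andP[/andP[f0 sf] aF] sF].
rewrite cat_uniq => /and3P[uf dis uF].
have [] := IH _ uF; first by rewrite /string_decomposition aF (path_sorted sF).
have : string_decomposition ltn (runs (flatten (map rev F))).
  exact: strings_decomposition.
have flE := flatten_strings ltn (flatten (map rev F)).
have r0 : (runs (flatten (map rev F)) == [::]) = (F == [::]).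
  rewrite strings_eq0; case: (F) aF => [//|[|x g] F'] //= _.
  by rewrite rev_cons -cats1 -catA; case: (rev g).
move: flE r0; rewrite -/runs; set us := runs _ => flE r0 dus ov hd.
have srf : sorted ltn (rev f) by rewrite rev_sorted.
have rf0 : rev f != [::] by rewrite -size_eq0 size_rev size_eq0.
rewrite -flE.
case: us r0 dus ov hd {flE} => [|u us] r0 dus ov hd.
  rewrite /= cats0.
  have -> : runs (rev f) = [:: rev f].
    by rewrite -[X in runs X]cats0 /runs (@strings_flatten _ [:: rev f]) // /string_decomposition /= rf0 srf.
  by rewrite /= last_rev_head.
case: F aF sF {IH} dis uF r0 hd => [//|g F] /= /andP[/andP[g0 sg] aF] /andP[br sF] dis uF _ hd.
have lt_fg : last 0 f < head 0 g.
  move: br; rewrite -leqNgt leq_eqVlt => /orP[/eqP E|//].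
  case/negP: dis; apply/hasP; exists (head 0 g).
    by case: (g) g0 => //= x ? _; rewrite mem_head.
  by rewrite -E; case: (f) f0 => //= x ? _; rewrite mem_last.
move: dus => /andP[/= /andP[/andP[u0 su] aus] sus].
(* The reversed fall either merges with the first run of what follows or is a run by itself; only
   the second case creates a new overlap to check. *)
have [lt|ge] := boolP (last 0 (rev f) < head 0 u).
- have -> : runs (rev f ++ u ++ flatten us) = (rev f ++ u) :: us.
    rewrite catA /runs (@strings_flatten _ ((rev f ++ u) :: us)) // /string_decomposition /= aus andbT -andbA.
    apply/and3P; split.
    + by case: (rev f) rf0.
    + case: (rev f) rf0 srf lt => [//|x v] _ /= pv lt.
      by rewrite cat_path pv; case: (u) u0 lt su => [//|y u'] _ /= -> ->.
    + case: (us) sus => [//|v vs] /=.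
      by rewrite last_cat; case: (u) u0.
  have hf : head 0 (rev f) <= last 0 (rev f) by apply: sorted_ltn_head_last.
  have hu : head 0 u <= last 0 u by apply: sorted_ltn_head_last.
  split.
    case: (us) ov => [//|v vs] /= /andP[ouv ->]; rewrite andbT.
    have -> : overlap (rev f ++ u) v = (head 0 (rev f) < last 0 v).
      by rewrite /overlap; case: (rev f) rf0.
    by apply: leq_ltn_trans ouv; apply: leq_trans hf (ltnW lt).
  have -> : last 0 (rev f ++ u) = last 0 u by rewrite last_cat; case: (u) u0.
  by rewrite last_rev_head in lt; apply: leq_trans (ltnW lt) hu.
- have -> : runs (rev f ++ u ++ flatten us) = [:: rev f, u & us].
    by rewrite /runs (@strings_flatten _ [:: rev f, u & us]) // /string_decomposition /= rf0 srf u0 su aus ge.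
  rewrite /= last_rev_head leqnn; split=> //.
  rewrite (_ : overlap _ _) //=; rewrite /overlap head_rev_last.
  exact: leq_trans lt_fg hd.
Qed.

(** An overlap between two runs is an ascent between their reversals, so the reversed runs are
    exactly the falls of the concatenation, and the flip restores them. *)
Lemma flip_rev_runs (w : seq nat) :
  sorted overlap (runs w) -> flip (flatten (map rev (runs w))) = w.
Proof.
move=> ov; rewrite /flip /falls strings_flatten.
  by rewrite -map_comp (eq_map revK) map_id flatten_strings.
have /andP[ar _] := strings_decomposition ltn w.
apply/andP; split.
  rewrite all_map; apply: sub_all ar => u /= /andP[u0 su].
  by rewrite -size_eq0 size_rev size_eq0 u0 rev_sorted.
rewrite sorted_map; apply: sub_sorted ov => u v /=.
by rewrite last_rev_head head_rev_last -leqNgt => /ltnW.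
Qed.

Lemma word_perm (n : nat) (s : 'S_n) : perm_eq (word s) (iota 1 n).
Proof.
have wE : word s = [seq (val i).+1 | i <- [seq s i | i <- enum 'I_n]].
  by rewrite -map_comp.
rewrite wE; apply: (@perm_trans _ [seq (val i).+1 | i <- enum 'I_n]).
  apply: perm_map; apply: uniq_perm; rewrite ?enum_uniq //.
    by rewrite map_inj_uniq ?enum_uniq //; apply: perm_inj.
  move=> i; rewrite mem_enum; apply/mapP; exists ((s^-1)%g i); rewrite ?mem_enum //.
  by rewrite permKV.
by rewrite (map_comp S val) val_enum_ord -(iotaDl 1).
Qed.

Lemma word_inj (n : nat) : injective (@word n).
Proof.
move=> s t; rewrite /word => /eq_in_map E; apply/permP => i.
by apply: val_inj; case: (E i (mem_enum _ _)).
Qed.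

Lemma perm_word_permutations (n : nat) :
  perm_eq [seq word s | s : 'S_n] (permutations (iota 1 n)).
Proof.
have uw : uniq [seq word s | s : 'S_n].
  by rewrite map_inj_uniq ?enum_uniq //; apply: word_inj.
have sub : {subset [seq word s | s : 'S_n] <= permutations (iota 1 n)}.
  by move=> w /mapP[s _ ->]; rewrite mem_permutations word_perm.
apply: uniq_perm; rewrite ?permutations_uniq //.
apply: (uniq_min_size uw sub _).2.
by rewrite size_permutations ?iota_uniq // size_iota size_map -cardE card_Sn.
Qed.

(** Moves counting from permutations to words, where appending and renaming letters are list
    operations. *)
Lemma card_word (n : nat) (P : pred (seq nat)) :
  #|[set s : 'S_n | P (word s)]| = count P (permutations (iota 1 n)).
Proof.
rewrite -(seq.permP (perm_word_permutations n)) count_map cardsE cardE.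
rewrite {1}/enum_mem size_filter -enumT.
exact: eq_count.
Qed.

Lemma pop_stacked_overlap (n : nat) (s : 'S_n) :
  pop_stacked s = sorted overlap (runs (word s)).
Proof.
apply/existsP/idP => [[t /eqP <-]|ov].
  apply: overlap_runs_flip; by rewrite (perm_uniq (word_perm t)) iota_uniq.
have: flatten (map rev (runs (word s))) \in permutations (iota 1 n).
  rewrite mem_permutations; apply: perm_trans (word_perm s).
  rewrite -[X in perm_eq _ X](flatten_strings ltn).
  rewrite -/(runs _); elim: (runs (word s)) => [//|u us IH] /=.
  by apply: perm_cat IH; rewrite perm_rev.
rewrite -(perm_mem (perm_word_permutations n)) => /mapP[t _ E].
by exists t; rewrite -E flip_rev_runs.
Qed.

(** * Counting by the last letter *)

Lemma permutations_iotaP (n : nat) (z : seq nat) :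
  reflect [/\ uniq z, size z = n & forall x, x \in z -> 1 <= x <= n]
          (z \in permutations (iota 1 n)).
Proof.
rewrite mem_permutations; apply: (iffP idP) => [zn|[uz sz rz]].
  split; first by rewrite (perm_uniq zn) iota_uniq.
    by rewrite (perm_size zn) size_iota.
  by move=> x; rewrite (perm_mem zn) mem_iota add1n ltnS.
apply: uniq_perm => //; first exact: iota_uniq.
apply: (uniq_min_size uz _ _).2; last by rewrite size_iota sz.
by move=> x /rz; rewrite mem_iota add1n ltnS.
Qed.

(* The permutation whose last letter is c and whose other letters are in the
   same relative order as those of z. *)
Definition append_letter (c : nat) (z : seq nat) : seq nat :=
  rcons (map (bump c) z) c.

Lemma bump_inj (c : nat) : injective (bump c).
Proof. exact: can_inj (bumpK c). Qed.

Lemma ltn_bump2 (c x y : nat) : (bump c x < bump c y) = (x < y).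
Proof. by rewrite !ltnNge leq_bump2. Qed.

Lemma bump_lt (c x : nat) : (bump c x < c) = (x < c).
Proof. by rewrite /bump; case: leqP => ?; apply/idP/idP; lia. Qed.

(** One inclusion is enough: appending is injective in the pair (letter, word), and both lists have
    (n+1)! entries. *)
Lemma perm_append_letter (n : nat) :
  perm_eq (permutations (iota 1 n.+1))
    [seq append_letter c z | c <- iota 1 n.+1, z <- permutations (iota 1 n)].
Proof.
rewrite perm_sym.
have ua : uniq [seq append_letter c z | c <- iota 1 n.+1,
                                       z <- permutations (iota 1 n)].
  apply: allpairs_uniq; rewrite ?iota_uniq ?permutations_uniq //.
  move=> [c z] [d y] _ _ /= /rcons_inj[E cd]; subst d.
  by rewrite (inj_map (@bump_inj c) E).
apply: uniq_perm; rewrite ?permutations_uniq //.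
apply: (uniq_min_size ua _ _).2; last first.
  by rewrite size_allpairs !size_permutations ?iota_uniq // !size_iota factS.
move=> w /allpairsP[[c z] []]; rewrite mem_iota [(c, z).1]/= [(c, z).2]/=.
rewrite add1n ltnS => /andP[c0 cn] /permutations_iotaP[uz sz rz] ->.
apply/permutations_iotaP; split.
- rewrite rcons_uniq (map_inj_uniq (@bump_inj c)) uz andbT.
  by apply/mapP => -[x _ /eqP]; rewrite (negbTE (neq_bump _ _)).
- by rewrite size_rcons size_map sz.
move=> x; rewrite mem_rcons inE => /orP[/eqP ->|/mapP[y /rz yr ->]]; first by rewrite c0.
by rewrite /bump; lia.
Qed.

Lemma count_sum (T : Type) (P : pred T) (s : seq T) :
  count P s = \sum_(z <- s) P z.
Proof. by rewrite -sum1_count big_mkcond; apply: eq_bigr => z _; case: (P z). Qed.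

Lemma sum_pick (T : eqType) (r : seq T) (x0 : T) (X : T -> bool) :
  uniq r -> \sum_(x <- r) ((x == x0) && X x) = (x0 \in r) && X x0 :> nat.
Proof.
elim: r => [|x r IH] /=; first by rewrite big_nil.
case/andP => xr /IH E; rewrite big_cons E inE eq_sym.
by have [->|_] := eqVneq x0 x; rewrite //= (negbTE xr) addn0.
Qed.

Lemma count_append_letter (P : pred (seq nat)) (n : nat) :
  count P (permutations (iota 1 n.+1)) =
  \sum_(1 <= c < n.+2) count (P \o append_letter c) (permutations (iota 1 n)).
Proof.
rewrite (seq.permP (perm_append_letter n)) count_flatten sumnE !big_map.
by rewrite /index_iota subn1; apply: eq_bigr => c _; rewrite count_map.
Qed.

(** * Runs of a word with an appended letter *)

Definition last_run (z : seq nat) : seq nat := last [::] (runs z).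

(* For a singleton u this is the only entry of u, by truncated subtraction. *)
Definition second_last (u : seq nat) : nat := nth 0 u (size u - 2).

(** The predicate [kp] on the number of runs makes one count serve twice: [pred1 k] gives the
    refined numbers of the theorem, [predT] the totals computed by the program. *)
Definition overlapping (kp : pred nat) (z : seq nat) : bool :=
  [&& z != [::], sorted overlap (runs z) & kp (size (runs z))].

Definition overlapping_abc (kp : pred nat) (a b c : nat) (z : seq nat) : bool :=
  [&& a == head 0 (last_run z), b == second_last (last_run z),
      c == last 0 (last_run z) & overlapping kp z].

Definition count_abc (n : nat) (kp : pred nat) (a b c : nat) : nat :=
  count (overlapping_abc kp a b c) (permutations (iota 1 n)).

(** A word determines its triple, so a nested sum counts it once if the triple lies in the range and
    not at all otherwise. Identities between sums thereby become equivalences between conditions on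
    a single word. *)
Lemma sum_count_abc (n : nat) (kp : pred nat) (ra : seq nat)
    (rb : nat -> seq nat) (rc : nat -> nat -> seq nat) :
  uniq ra -> (forall a, uniq (rb a)) -> (forall a b, uniq (rc a b)) ->
  \sum_(a <- ra) \sum_(b <- rb a) \sum_(c <- rc a b) count_abc n kp a b c =
  count (fun z => let a := head 0 (last_run z) in
           let b := second_last (last_run z) in
           let c := last 0 (last_run z) in
           [&& a \in ra, b \in rb a, c \in rc a b & overlapping kp z])
    (permutations (iota 1 n)).
Proof.
move=> ua ub uc; rewrite count_sum /=.
under eq_bigr => a _.
  under eq_bigr => b _.
    under eq_bigr => c _ do rewrite /count_abc count_sum.
    rewrite exchange_big /=; over.
  rewrite exchange_big /=; over.
rewrite exchange_big /=; apply: eq_bigr => z _.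
set a0 := head 0 _; set b0 := second_last _; set c0 := last 0 _.
have Ec a b : \sum_(c <- rc a b) overlapping_abc kp a b c z =
    (b == b0) && [&& c0 \in rc a b, a == a0 & overlapping kp z] :> nat.
  rewrite (eq_bigr (fun c => nat_of_bool ((c == c0) &&
      [&& b == b0, a == a0 & overlapping kp z]))) => [|c _].
    by rewrite sum_pick // andbCA.
  by rewrite /overlapping_abc -/a0 -/b0 -/c0; do ![case: (_ == _)].
have Eb a : \sum_(b <- rb a) \sum_(c <- rc a b) overlapping_abc kp a b c z =
    (a == a0) && [&& b0 \in rb a, c0 \in rc a b0 & overlapping kp z] :> nat.
  rewrite (eq_bigr _ (fun b _ => Ec a b)) sum_pick //.
  by do ![case: (_ \in _)]; case: (_ == _).
by rewrite (eq_bigr _ (fun a _ => Eb a)) sum_pick.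
Qed.

Lemma runs_last (z : seq nat) : z != [::] ->
  exists us u, [/\ runs z = rcons us u, u != [::], sorted ltn u,
     last 0 u = last 0 z & all (fun v => v != [::]) us].
Proof.
move=> z0; have := strings_decomposition ltn z.
have := flatten_strings ltn z; have := strings_eq0 ltn z.
rewrite -/(runs z); case: (lastP (runs z)) => [|us u]; first by rewrite eqxx (negbTE z0).
move=> _ fz /andP[]; rewrite all_rcons => /andP[/andP[u0 su] aus] _.
exists us, u; split=> //; last by apply: sub_all aus => v /andP[].
by rewrite -fz flatten_rcons last_cat; case: (u) u0.
Qed.

Lemma last_map_neq0 (f : nat -> nat) (u : seq nat) :
  u != [::] -> last 0 (map f u) = f (last 0 u).
Proof. by case: u => [//|x u] _ /=; rewrite last_map. Qed.

Lemma head_map_neq0 (f : nat -> nat) (u : seq nat) :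
  u != [::] -> head 0 (map f u) = f (head 0 u).
Proof. by case: u. Qed.

Lemma sorted_rcons2 (T : Type) (e : rel T) (s : seq T) (x y : T) :
  sorted e (rcons (rcons s x) y) = sorted e (rcons s x) && e x y.
Proof. by case: s => [|z s] /=; rewrite ?andbT // rcons_path last_rcons. Qed.

Lemma sorted_ltn_rcons (u : seq nat) (c : nat) :
  sorted ltn u -> last 0 u < c -> sorted ltn (rcons u c).
Proof. by case: u => [//|x u] /=; rewrite rcons_path => -> /= ->. Qed.

(** Renaming by [bump c] preserves order, hence runs. Only the junction with [c] is new, and it can
    be tested before renaming because [bump c x < c] is equivalent to [x < c]. *)
Lemma runs_append_letter (c : nat) (z : seq nat) (us : seq (seq nat)) (u : seq nat) :
  runs z = rcons us u ->
  runs (append_letter c z) =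
  if last 0 u < c then
    rcons (map (map (bump c)) us) (rcons (map (bump c) u) c)
  else rcons (rcons (map (map (bump c)) us) (map (bump c) u)) [:: c].
Proof.
move=> rz.
have rE : runs (map (bump c) z) = rcons (map (map (bump c)) us) (map (bump c) u).
  rewrite /runs (strings_map _ (ltn_bump2 c)).
  by move: rz; rewrite /runs => ->; rewrite map_rcons.
have u0 : u != [::].
  have := strings_decomposition ltn z.
  by rewrite -/(runs z) rz => /andP[]; rewrite all_rcons => /andP[/andP[]].
have lu : last 0 (map (bump c) u) = bump c (last 0 u) by rewrite last_map_neq0.
have := strings_decomposition ltn (map (bump c) z).
have := flatten_strings ltn (map (bump c) z).
rewrite -/(runs _) rE; move: (map (map (bump c)) us) => vs.
have: map (bump c) u != [::] by case: (u) u0.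
move: (map (bump c) u) lu => v lv v0.
rewrite flatten_rcons => fE /andP[]; rewrite all_rcons => /andP[/andP[_ sv] avs] svs.
rewrite /append_letter -fE; case: ifP => [lt|ge].
  rewrite -(@strings_flatten ltn (rcons vs (rcons v c))).
    by rewrite flatten_rcons rcons_cat.
  apply/andP; split.
    rewrite all_rcons avs andbT sorted_ltn_rcons ?lv ?bump_lt //.
    by case: (v).
  case/lastP: vs svs {fE avs} => [//|vs t].
  rewrite !sorted_rcons2 => /andP[-> /=].
  by case: (v) v0.
rewrite -(@strings_flatten ltn (rcons (rcons vs v) [:: c])).
  by rewrite !flatten_rcons cats1.
apply/andP; split; first by rewrite !all_rcons v0 sv avs.
by rewrite sorted_rcons2 svs /= lv bump_lt ge.
Qed.

(** The demand that the runs [us] make on a following run with largest entry [c]. No other entry of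
    that run matters, which allows the removal of its smaller letters. *)
Definition overlap_upto (us : seq (seq nat)) (c : nat) : bool :=
  sorted overlap us && ((us == [::]) || (head 0 (last [::] us) < c)).

Lemma sorted_overlap_rcons (us : seq (seq nat)) (v : seq nat) :
  sorted overlap (rcons us v) = overlap_upto us (last 0 v).
Proof.
case/lastP: us => [//|us u]; rewrite sorted_rcons2 /overlap_upto last_rcons.
by case: us.
Qed.

(** For b < c, [bump b x < c] is equivalent to [x < c.-1]. This shift is the origin of C-1 and C-2
    in the recurrence. *)
Lemma overlap_upto_bump (us : seq (seq nat)) (b c : nat) :
  all (fun v => v != [::]) us -> b < c ->
  overlap_upto (map (map (bump b)) us) c = overlap_upto us c.-1.
Proof.
move=> aus bc; rewrite /overlap_upto sorted_map; congr (_ && _).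
  apply: (eq_in_sorted (P := fun v => v != [::])) => // u v u0 v0 /=.
  by rewrite /overlap head_map_neq0 // last_map_neq0 // ltn_bump2.
case/lastP: us aus => [//|us u]; rewrite all_rcons => /andP[u0 _].
rewrite map_rcons !last_rcons head_map_neq0 //.
by congr (_ || _); [case: (us)|rewrite /bump; case: leqP => ?; apply/idP/idP; lia].
Qed.

Lemma overlap_upto_bump_eq (us : seq (seq nat)) (c : nat) :
  all (fun v => v != [::]) us ->
  overlap_upto (map (map (bump c)) us) c = overlap_upto us c.
Proof.
move=> aus; rewrite /overlap_upto sorted_map; congr (_ && _).
  apply: (eq_in_sorted (P := fun v => v != [::])) => // u v u0 v0 /=.
  by rewrite /overlap head_map_neq0 // last_map_neq0 // ltn_bump2.
case/lastP: us aus => [//|us u]; rewrite all_rcons => /andP[u0 _].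
rewrite map_rcons !last_rcons head_map_neq0 // bump_lt.
by case: (us).
Qed.

Lemma append_letter_neq0 (c : nat) (z : seq nat) : append_letter c z != [::].
Proof. by rewrite /append_letter; case: (map _ _). Qed.

Section AppendToRuns.
Variables (kp : pred nat) (z : seq nat) (us : seq (seq nat)) (u : seq nat).
Hypotheses (rz : runs z = rcons us u) (u0 : u != [::]) (su : sorted ltn u).
Hypothesis aus : all (fun v => v != [::]) us.

Lemma overlapping_rcons :
  overlapping kp z = overlap_upto us (last 0 u) && kp (size us).+1.
Proof.
rewrite /overlapping rz sorted_overlap_rcons size_rcons.
have := strings_eq0 ltn z; rewrite -/(runs z) rz => <-.
by case: (us).
Qed.

Lemma overlapping_abc_descent (a b c d : nat) : d <= last 0 u ->
  overlapping_abc kp a b c (append_letter d z) =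
  [&& a == d, b == d, c == d, overlap_upto us (last 0 u), head 0 u < d
    & kp (size us).+2].
Proof.
move=> du; rewrite /overlapping_abc /overlapping /last_run.
rewrite (runs_append_letter d rz) ltnNge du /= last_rcons append_letter_neq0 /=.
rewrite sorted_rcons2 -map_rcons.
rewrite -(sorted_overlap_rcons us u).
have aus' : all (fun v => v != [::]) (rcons us u) by rewrite all_rcons u0.
have -> : sorted overlap [seq map (bump d) i | i <- rcons us u] =
          sorted overlap (rcons us u).
  rewrite sorted_map.
  apply: (eq_in_sorted (P := fun v => v != [::])) => // v w v0 w0 /=.
  by rewrite /overlap head_map_neq0 // last_map_neq0 // ltn_bump2.
rewrite {2}/overlap head_map_neq0 // bump_lt !size_rcons size_map.
by rewrite size_rcons /second_last /= -!andbA.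
Qed.

(** The old maximum of the last run becomes its second-largest entry, and the overlap with [us] is
    now tested at [d]. It may have failed at [last 0 u], so [z] need not be overlapping. *)
Lemma overlapping_abc_ascent (a b c d : nat) : last 0 u < d ->
  overlapping_abc kp a b c (append_letter d z) =
  [&& a == head 0 u, b == last 0 u, c == d, overlap_upto us d
    & kp (size us).+1].
Proof.
move=> ud; rewrite /overlapping_abc /overlapping /last_run.
rewrite (runs_append_letter d rz) ud last_rcons append_letter_neq0 /=.
rewrite sorted_overlap_rcons last_rcons overlap_upto_bump_eq // size_rcons size_map.
have hu := sorted_ltn_head_last su.
have bE x : x < d -> bump d x = x by rewrite /bump; case: leqP.
have -> : head 0 (rcons (map (bump d) u) d) = head 0 u.
  by rewrite -[RHS]bE ?(leq_ltn_trans hu ud) //; case: (u) u0.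
have -> : second_last (rcons (map (bump d) u) d) = last 0 u.
  rewrite -[RHS]bE // /second_last size_rcons nth_rcons size_map.
  have -> : (size u).+1 - 2 = (size u).-1 by case: (size u) => // k; rewrite subSS subn1.
  have lt : (size u).-1 < size u by case: (u) u0 => //= *; exact: ltnSn.
  by rewrite lt (nth_map 0) // nth_last.
by [].
Qed.

End AppendToRuns.

Lemma last_last_run (z : seq nat) : last 0 (last_run z) = last 0 z.
Proof.
have [->//|z0] := eqVneq z [::]; rewrite /last_run.
by have [us [u [-> _ _ <- _]]] := runs_last z0; rewrite last_rcons.
Qed.

Lemma last_append_letter (c : nat) (z : seq nat) : last 0 (append_letter c z) = c.
Proof. by rewrite last_rcons. Qed.

Lemma count_abc_last (n : nat) (kp : pred nat) (a b c : nat) :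
  1 <= c <= n.+1 ->
  count_abc n.+1 kp a b c =
  count (overlapping_abc kp a b c \o append_letter c) (permutations (iota 1 n)).
Proof.
move=> cn; rewrite /count_abc count_append_letter (bigD1_seq c) ?iota_uniq //=; last first.
  by rewrite mem_index_iota ltnS.
rewrite big1 ?addn0 // => d dc; apply/eqP; rewrite -leqn0 leqNgt -has_count.
apply/hasPn => z _ /=; rewrite /overlapping_abc last_last_run last_append_letter.
by rewrite [c == d]eq_sym (negbTE dc) /= !andbF.
Qed.

Lemma count_abc_last2 (n : nat) (kp : pred nat) (a b c : nat) :
  1 <= a <= b -> b < c <= n.+2 ->
  count_abc n.+2 kp a b c =
  count (fun z => overlapping_abc kp a b c (append_letter c (append_letter b z)))
    (permutations (iota 1 n)).
Proof.
move=> ab bc; rewrite count_abc_last; last by lia.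
rewrite count_append_letter (bigD1_seq b) ?iota_uniq //=; last first.
  by rewrite mem_index_iota; lia.
rewrite big1 ?addn0 // => d db; apply/eqP; rewrite -leqn0 leqNgt -has_count.
apply/hasPn => z _ /=.
have [us [u [rz u0 su]]] := runs_last (append_letter_neq0 d z).
rewrite last_append_letter => lu aus.
(* If the earlier letter is at least [c], then [c] is a run by itself and a = c, against a <= b <
   c. *)
have [cd|dc] := leqP c d.
  rewrite (overlapping_abc_descent _ rz) ?lu //.
  by case: eqP => //= ac; lia.
rewrite (overlapping_abc_ascent _ rz) ?lu // (negbTE (_ : b != d)) 1?eq_sym //.
by rewrite !andbF.
Qed.

Lemma permutations_iotaS_neq0 (n : nat) (z : seq nat) :
  z \in permutations (iota 1 n.+1) -> z != [::].
Proof. by case/permutations_iotaP => _ + _; case: z. Qed.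

Lemma second_last_bounds (u : seq nat) : sorted ltn u ->
  head 0 u <= second_last u <= last 0 u.
Proof.
case: u => [//|x u] su; rewrite -nth0 -nth_last /second_last.
have/(sorted_leq_nth leq_trans leqnn) E : sorted leq (x :: u).
  by apply: sub_sorted su => y t; exact: ltnW.
by rewrite !E ?inE //=; lia.
Qed.

Lemma last_run_bounds (n : nat) (z : seq nat) :
  z \in permutations (iota 1 n) -> z != [::] ->
  [/\ 1 <= head 0 (last_run z), head 0 (last_run z) <= second_last (last_run z),
      second_last (last_run z) <= last 0 (last_run z)
    & last 0 (last_run z) <= n].
Proof.
case/permutations_iotaP => _ _ rgz z0; rewrite /last_run.
have [us [u [rz u0 su lu aus]]] := runs_last z0; rewrite rz last_rcons.
have sub x : x \in u -> 1 <= x <= n.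
  move=> xu; apply: rgz; rewrite -(flatten_strings ltn z) -/(runs z) rz.
  by rewrite flatten_rcons mem_cat xu orbT.
have /andP[-> ->] := second_last_bounds su.
have /sub/andP[-> _] : head 0 u \in u by case: (u) u0 => //= *; apply: mem_head.
have /sub/andP[_ ->] // : last 0 u \in u.
by case: (u) u0 => //= *; apply: mem_last.
Qed.

(** * Last runs with one, two, and at least three letters *)

(** Without its last letter the word is still overlapping and has one run fewer. The descent to [a]
    asks its last letter to be at least [a], the overlap asks its last run to start below [a]. *)
Lemma count_abc_singleton (n : nat) (kp : pred nat) (a : nat) :
  1 <= a <= n.+2 ->
  count_abc n.+2 kp a a a =
  \sum_(1 <= a' < a) \sum_(1 <= b < n.+2) \sum_(a <= c < n.+2)
    count_abc n.+1 (fun k => kp k.+1) a' b c.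
Proof.
move=> an; rewrite count_abc_last //.
rewrite (@sum_count_abc _ _ _ (fun _ => index_iota 1 n.+2)
  (fun _ _ => index_iota a n.+2));
  do ?[exact: iota_uniq|move=> *; exact: iota_uniq].
apply: eq_in_count => z zn; have z0 := permutations_iotaS_neq0 zn.
have [/=] := last_run_bounds zn z0.
have [us [u [rz u0 su lu aus]]] := runs_last z0.
rewrite /last_run rz last_rcons !mem_index_iota => h1 h2 h3 h4.
rewrite (overlapping_rcons _ rz).
have [ge|lt] := leqP a (last 0 u).
  rewrite (overlapping_abc_descent _ rz) // eqxx h1 /=.
  have -> : 0 < second_last u < n.+2 by lia.
  have -> /= : last 0 u < n.+2 by lia.
  by rewrite andbCA.
rewrite (overlapping_abc_ascent _ rz) //.
have -> : (a == last 0 u) = false by apply/eqP; lia.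
by rewrite /= !andbF.
Qed.

(** Both letters go at once, because the word without [c] alone need not be overlapping. The
    preceding run must start below [c], which means below [c.-1] once the smaller letter [a] is
    gone. *)
Lemma count_abc_pair (n : nat) (kp : pred nat) (a c : nat) :
  1 <= a < c -> c <= n.+3 ->
  count_abc n.+3 kp a a c =
  \sum_(1 <= a' < c.-1) \sum_(1 <= b < n.+2) \sum_(a <= c' < n.+2)
    count_abc n.+1 (fun k => kp k.+1) a' b c'.
Proof.
move=> ac cn; rewrite count_abc_last2 ?leqnn ?andbT; [|lia|lia].
rewrite (@sum_count_abc _ _ _ (fun _ => index_iota 1 n.+2)
  (fun _ _ => index_iota a n.+2));
  do ?[exact: iota_uniq|move=> *; exact: iota_uniq].
apply: eq_in_count => z zn; have z0 := permutations_iotaS_neq0 zn.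
have [/=] := last_run_bounds zn z0.
have [us [u [rz u0 su lu aus]]] := runs_last z0.
rewrite /last_run rz last_rcons !mem_index_iota => h1 h2 h3 h4.
rewrite (overlapping_rcons _ rz).
have := runs_append_letter a rz.
have [lt|ge] := leqP a (last 0 u) => ra.
  have aus' : all (fun v => v != [::]) (rcons us u) by rewrite all_rcons u0.
  rewrite (overlapping_abc_ascent _ ra) /=; last by case/andP: ac.
    rewrite -map_rcons overlap_upto_bump //; last by case/andP: ac.
    rewrite /overlap_upto last_rcons sorted_overlap_rcons !eqxx h1.
    have -> /= : rcons us u == [::] = false by case: (us).
    rewrite map_rcons size_rcons size_map.
    have -> : 0 < second_last u < n.+2 by lia.
    have -> /= : last 0 u < n.+2 by lia.
    by rewrite -andbA andbCA.
  all: rewrite //.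
  by rewrite -map_rcons all_map; apply: sub_all aus' => v /=; case: v.
(* Here [a] lies above the last letter of [z] and extends its last run, so the smallest entry of
   that run is not [a]; both sides vanish. *)
rewrite (overlapping_abc_ascent _ ra) ?last_rcons; last by case/andP: ac.
- have -> : head 0 (rcons (map (bump a) u) a) = bump a (head 0 u) by case: (u) u0.
  have -> : a == bump a (head 0 u) = false by apply/eqP; rewrite /bump; lia.
  by rewrite /= !andbF.
- by case: (map _ u).
- apply: sorted_ltn_rcons; last by rewrite last_map_neq0 // bump_lt.
  by rewrite sorted_map; apply: sub_sorted su => x y; rewrite /= ltn_bump2.
- by rewrite all_map; apply: sub_all aus => v /=; case: v.
Qed.

(** Deleting [b] keeps the largest letter, now [c.-1], and with it the overlap with the preceding
    run. The new second-largest letter is any b' below b; it equals [a] if the run had three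
    letters. *)
Lemma count_abc_remove (n : nat) (kp : pred nat) (a b c : nat) :
  1 <= a < b -> b < c <= n.+2 ->
  count_abc n.+2 kp a b c = \sum_(a <= b' < b) count_abc n.+1 kp a b' c.-1.
Proof.
move=> ab bc; rewrite count_abc_last2 //; last by lia.
have n0 : 0 < n by lia.
(* Both sides are compared on the same [z], obtained by deleting [b] and [c] on the left, and the
   single letter [c.-1] on the right. *)
under eq_big_nat => b' hb' do (rewrite count_abc_last; last by lia).
rewrite count_sum; under [RHS]eq_bigr => b' _ do rewrite count_sum.
rewrite exchange_big /=; apply: eq_big_seq => z zn.
have z0 : z != [::] by case/permutations_iotaP: zn => _ sz _; rewrite -size_eq0 sz -lt0n.
have [us [u [rz u0 su lu aus]]] := runs_last z0.
have hu := sorted_ltn_head_last su.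
have rb := runs_append_letter b rz.
have [lt|ge] := ltnP (last 0 u) b.
  rewrite lt in rb.
  have bh : bump b (head 0 u) = head 0 u by rewrite /bump; lia.
  rewrite (overlapping_abc_ascent _ rb) ?last_rcons; last by lia.
  + have -> : head 0 (rcons (map (bump b) u) b) = head 0 u.
      by rewrite -[RHS]bh; case: (u) u0.
    rewrite eqxx overlap_upto_bump ?size_map ?eqxx //=; last by lia.
    rewrite (eq_bigr (fun i => nat_of_bool ((i == last 0 u) && [&& a == head 0 u,
      overlap_upto us c.-1 & kp (size us).+1]))) => [|i _]; last first.
      by rewrite (overlapping_abc_ascent _ rz) ?eqxx //=; [rewrite andbCA|lia].
    rewrite sum_pick ?iota_uniq // mem_index_iota lt andbT.
    by case: eqP => [->|]; rewrite /= ?hu ?andbF.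
  + by case: (map _ u).
  + apply: sorted_ltn_rcons; last by rewrite last_map_neq0 // bump_lt.
    by rewrite sorted_map; apply: sub_sorted su => x y; rewrite /= ltn_bump2.
  + by rewrite all_map; apply: sub_all aus => v /=; case: v.
(* Now [b] opens a run, so its smallest entry is [b] and not [a]. On the right, either [c.-1] is a
   run by itself, but a < c-1, or b' would have to be the last letter of [z], which is at least
   [b]. *)
rewrite ltnNge ge /= in rb.
rewrite (overlapping_abc_ascent _ rb) /=; last by lia.
- have -> : a == b = false by lia.
  rewrite big_nat big1 // => b' hb'.
  have [le|lt] := leqP c.-1 (last 0 u).
    rewrite (overlapping_abc_descent _ rz) //.
    by have -> : a == c.-1 = false by lia.
  rewrite (overlapping_abc_ascent _ rz) //.
  have -> : b' == last 0 u = false by lia.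
  by rewrite andbF.
- by [].
- by [].
have aus' : all (fun v => v != [::]) (rcons us u) by rewrite all_rcons u0.
by rewrite -map_rcons all_map; apply: sub_all aus' => v /=; case: v.
Qed.

(** * The recurrence *)

Lemma is_smallest_head (u : seq nat) (a : nat) :
  sorted ltn u -> u != [::] -> is_smallest u a = (a == head 0 u).
Proof.
case: u => [//|x u] /= su _; rewrite /is_smallest.
have xu : all (leq x) (x :: u).
  rewrite /= leqnn; apply: sub_all (order_path_min ltn_trans su) => y; exact: ltnW.
apply/andP/eqP => [[au /allP/(_ x (mem_head _ _)) ax]|->]; last by rewrite mem_head.
by apply/eqP; rewrite eqn_leq ax (allP xu).
Qed.

Lemma is_largest_last (u : seq nat) (c : nat) :
  sorted ltn u -> u != [::] -> is_largest u c = (c == last 0 u).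
Proof.
case/lastP: u => [//|u x] su _; rewrite last_rcons /is_largest.
have xu : all (fun y => y <= x) (rcons u x).
  rewrite all_rcons leqnn /=; apply/allP => y yu.
  move: su; rewrite -cats1; case: u yu => [//|z u] yu /=.
  rewrite cat_path /= andbT => /andP[pu lu].
  case/splitPl: yu pu lu => p q; rewrite last_cat => <-.
  rewrite cat_path => /andP[_ /(order_path_min ltn_trans)/allP pq] lx.
  have: last (last z p) q \in last z p :: q by apply: mem_last.
  rewrite inE => /orP[/eqP E|/pq /ltnW le]; first by rewrite -E ltnW.
  exact: leq_trans le (ltnW lx).
have xx : x \in rcons u x by rewrite mem_rcons mem_head.
apply/andP/eqP => [[cu /allP/(_ x xx) ax]|->]; last by [].
by apply/eqP; rewrite eqn_leq ax (allP xu).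
Qed.

Lemma rem_rcons (T : eqType) (v : seq T) (x : T) :
  x \notin v -> rem x (rcons v x) = v.
Proof.
elim: v => [|y v IH] /=; first by rewrite eqxx.
by rewrite inE negb_or eq_sym => /andP[/negbTE-> /IH->].
Qed.

Lemma run_parametersE (u : seq nat) (a b c : nat) :
  sorted ltn u -> u != [::] ->
  run_parameters u a b c =
  [&& a == head 0 u, b == second_last u & c == last 0 u].
Proof.
move=> su u0; rewrite /run_parameters is_smallest_head // is_largest_last //.
case: eqP => //= ->; case: eqP => /= [->|_]; rewrite ?andbF ?andbT //.
case/lastP: u su u0 => [//|v x] su _; rewrite last_rcons.
case/lastP: v su => [|v y] su; first by rewrite /= ltnn.
have yx : y < x by move: su; rewrite sorted_rcons2 => /andP[].
have sv : sorted ltn (rcons v y) by move: su; rewrite sorted_rcons2 => /andP[].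
have hy : head 0 (rcons v y) <= y by rewrite -{2}(last_rcons 0 v y); apply: sorted_ltn_head_last.
have -> : head 0 (rcons (rcons v y) x) = head 0 (rcons v y) by case: (v).
rewrite (leq_ltn_trans hy yx).
have xv : x \notin rcons v y.
  have: is_largest (rcons v y) y by rewrite is_largest_last ?last_rcons //; case: (v).
  by case/andP => _ /allP al; apply/negP => /al; rewrite leqNgt yx.
have -> : rem x (rcons (rcons v y) x) = rcons v y.
  exact: rem_rcons.
rewrite is_largest_last //; last by case: (v).
by rewrite /second_last !size_rcons subn2 /= !nth_rcons size_rcons ltnSn ltnn eqxx last_rcons.
Qed.

Lemma count_abc_eq0 (n : nat) (kp : pred nat) (a b c : nat) :
  ~~ [&& 1 <= a, a <= b, b <= c & c <= n] -> count_abc n kp a b c = 0.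
Proof.
move=> abc; apply/eqP; rewrite -leqn0 leqNgt -has_count.
apply/hasPn => z zn; apply: contra abc.
case/and4P => /eqP-> /eqP-> /eqP-> /and3P[z0 _ _].
by have [-> -> -> ->] := last_run_bounds zn z0.
Qed.

(** A run with distinct ends has an entry just before its largest one. This settles A < B = C, where
    all brackets of the recurrence are zero. *)
Lemma count_abc_eq0_second (n : nat) (kp : pred nat) (a c : nat) :
  a < c -> count_abc n kp a c c = 0.
Proof.
move=> ac; apply/eqP; rewrite -leqn0 leqNgt -has_count.
apply/hasPn => z zn; apply/negP => /and4P[/eqP E1 /eqP E2 /eqP E3 /and3P[z0 _ _]].
have [us [u [rz u0 su lu aus]]] := runs_last z0.
move: E1 E2 E3; rewrite /last_run rz last_rcons => E1 E2 E3.
case/lastP: u su E1 E2 E3 {rz u0 lu} => [|v x] su E1 E2 E3; first by subst; rewrite ltnn in ac.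
case/lastP: v su E1 E2 E3 => [|v y] su E1 E2 E3; first by move: ac; rewrite E1 E3 /= ltnn.
move: su E2 E3; rewrite sorted_rcons2 last_rcons => /andP[_ /= yx].
rewrite /second_last !size_rcons subn2 /= !nth_rcons size_rcons ltnSn ltnn eqxx => -> E.
by rewrite E ltnn in yx.
Qed.

Lemma popstacked_abcE (n k a b c : nat) :
  popstacked_abc n k a b c = count_abc n (pred1 k) a b c.
Proof.
rewrite /popstacked_abc; case: ifP => [/andP[n0 _]|].
  rewrite /count_abc -card_word; apply: eq_card => s; rewrite !inE.
  have z0 : word s != [::].
    by rewrite -size_eq0 (perm_size (word_perm s)) size_iota -lt0n.
  rewrite pop_stacked_overlap /overlapping_abc /overlapping z0 /=.
  have [us [u [rz u0 su lu aus]]] := runs_last z0.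
  rewrite /last_run rz last_rcons run_parametersE //.
  by do ![case: (_ == _) => //=]; rewrite ?andbT ?andbF.
move/negbT; rewrite negb_and => /orP[|/count_abc_eq0 -> //].
case: n => [_|//]; rewrite count_abc_eq0 //.
by apply/negP => /and4P[? ? ? ?]; lia.
Qed.

Lemma eq_count_abc (n : nat) (kp kp' : pred nat) (a b c : nat) :
  kp =1 kp' -> count_abc n kp a b c = count_abc n kp' a b c.
Proof.
by move=> E; apply: eq_count => z; rewrite /overlapping_abc /overlapping E.
Qed.

Lemma permutations_nil : permutations (iota 1 0) = [:: [::]].
Proof. by vm_compute. Qed.

Lemma count_abc_1 (kp : pred nat) : count_abc 1 kp 1 1 1 = kp 1.
Proof. by rewrite count_abc_last // permutations_nil; vm_compute; case: (kp 1). Qed.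

Lemma count_abc_2 (kp : pred nat) : count_abc 2 kp 1 1 2 = kp 1.
Proof. by rewrite count_abc_last2 // permutations_nil; vm_compute; case: (kp 1). Qed.

Lemma popstacked_abc_recurrence (N K A B C : nat) :
  1 <= N -> 1 <= K -> 1 <= A -> A <= B -> B <= C -> C <= N ->
  (N, K, A, B, C) <> (1, 1, 1, 1, 1) ->
  (N, K, A, B, C) <> (2, 1, 1, 1, 2) ->
  popstacked_abc N K A B C =
    ((A == B) && (B == C)) *
      (\sum_(1 <= a < (A - 1).+1) \sum_(1 <= b < (N - 1).+1)
         \sum_(A <= c < (N - 1).+1) popstacked_abc (N - 1) (K - 1) a b c)
  + ((A == B) && (B < C)) *
      (\sum_(1 <= a < (C - 2).+1) \sum_(1 <= b < (N - 2).+1)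
         \sum_(A <= c < (N - 2).+1) popstacked_abc (N - 2) (K - 1) a b c)
  + ((A < B) && (B < C)) *
      (\sum_(A <= b < (B - 1).+1) popstacked_abc (N - 1) K A b (C - 1)).
Proof.
move=> N1 K1 A1 AB BC CN ne1 ne2; rewrite popstacked_abcE.
have KE : (fun k => pred1 K k.+1) =1 pred1 (K - 1) by move=> k /=; lia.
move: AB; rewrite leq_eqVlt => /orP[/eqP AB|AB].
  subst B; rewrite eqxx ltnn /= mul0n addn0.
  move: BC; rewrite leq_eqVlt => /orP[/eqP AC|AC].
    subst C; rewrite eqxx ltnn mul0n addn0 mul1n.
    case: N N1 CN ne1 {ne2} => [//|[|n]] _ CN ne1.
      (* For size 1 the excluded tuple leaves only K > 1, where both sides are zero; the same
         happens for size 2 below. *)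
      have A1' : A = 1 by lia.
      subst A; rewrite count_abc_1 big_geq //.
      by rewrite (_ : pred1 K 1 = false) //; apply/eqP => E; case: ne1; rewrite -E.
    rewrite count_abc_singleton ?A1 // !subSS !subn0 (_ : (A - 1).+1 = A); last by lia.
    do 3![apply: eq_bigr => ? _].
    by rewrite popstacked_abcE; apply: eq_count_abc.
  rewrite AC (ltn_eqF AC) mul0n add0n mul1n.
  case: N N1 CN ne1 ne2 => [//|[|[|n]]] _ CN _ ne2; first by lia.
    have A1' : A = 1 by lia.
    have C2 : C = 2 by lia.
    subst A C; rewrite count_abc_2 big_geq //.
    by rewrite (_ : pred1 K 1 = false) //; apply/eqP => E; case: ne2; rewrite -E.
  rewrite count_abc_pair ?A1 // !subSS !subn0 (_ : (C - 2).+1 = C.-1); last by lia.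
  do 3![apply: eq_bigr => ? _].
  by rewrite popstacked_abcE; apply: eq_count_abc.
rewrite (ltn_eqF AB) AB !mul0n !add0n.
move: BC; rewrite leq_eqVlt => /orP[/eqP BC|BC].
  by subst C; rewrite ltnn mul0n count_abc_eq0_second.
rewrite BC mul1n; case: N N1 CN {ne1 ne2} => [//|[|n]] _ CN; first by lia.
rewrite count_abc_remove ?A1 ?BC // !subSS subn0 (_ : (B - 1).+1 = B); last by lia.
by rewrite subn1; apply: eq_bigr => b _; rewrite popstacked_abcE.
Qed.

Lemma popstacked_runsE (n k : nat) :
  popstacked_runs n k =
  count (fun z => sorted overlap (runs z) && (size (runs z) == k))
    (permutations (iota 1 n)).
Proof.
by rewrite -card_word; apply: eq_card => s; rewrite !inE pop_stacked_overlap.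
Qed.

Lemma popstackedE (n : nat) :
  popstacked n = count (fun z => sorted overlap (runs z)) (permutations (iota 1 n)).
Proof.
by rewrite -card_word; apply: eq_card => s; rewrite !inE pop_stacked_overlap.
Qed.

Lemma popstacked_runs_sum (n k : nat) : 1 <= n ->
  popstacked_runs n k =
  \sum_(1 <= a < n.+1) \sum_(a <= b < n.+1) \sum_(b <= c < n.+1)
     popstacked_abc n k a b c.
Proof.
case: n => [//|n] _; rewrite popstacked_runsE.
under [RHS]eq_bigr => a _. under eq_bigr => b _.
  under eq_bigr => c _ do rewrite popstacked_abcE. over. over.
rewrite (@sum_count_abc _ _ _ (fun a => index_iota a n.+2)
  (fun _ b => index_iota b n.+2)); do ?[exact: iota_uniq|move=> *; exact: iota_uniq].
apply: eq_in_count => z zn; have z0 := permutations_iotaS_neq0 zn.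
have [h1 h2 h3 h4] := last_run_bounds zn z0.
rewrite /= !mem_index_iota !ltnS h1 h2 h3 h4 (leq_trans h3 h4).
by rewrite (leq_trans h2 (leq_trans h3 h4)) /overlapping z0.
Qed.

Lemma popstacked_sum (n : nat) : 1 <= n ->
  popstacked n = \sum_(1 <= k < n.+1) popstacked_runs n k.
Proof.
case: n => [//|n] _; rewrite popstackedE count_sum.
under [RHS]eq_bigr => k _ do rewrite popstacked_runsE count_sum.
rewrite exchange_big /=; apply: eq_big_seq => z zn.
have z0 := permutations_iotaS_neq0 zn.
under eq_bigr => k _ do rewrite andbC eq_sym.
rewrite (sum_pick _ (fun=> sorted overlap (runs z))) ?iota_uniq // mem_index_iota.
have [_ sz _] := elimT (permutations_iotaP n.+1 z) zn.
by rewrite ltnS -sz size_strings lt0n size_eq0 strings_eq0 z0.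
Qed.

(** * Totals over the number of runs *)

Definition row_sum (n a c : nat) : nat :=
  \sum_(1 <= b < n.+1) count_abc n predT a b c.

Definition prefix_sum (n a b c : nat) : nat :=
  \sum_(a <= b' < b.+1) count_abc n predT a b' c.

(* The value at n = 0 makes the recurrence cover both initial conditions. *)
Definition corner_sum (n x y : nat) : nat :=
  if n is 0 then (x == 0) && (y == 1)
  else \sum_(1 <= a < x.+1) \sum_(y <= c < n.+1) row_sum n a c.

Lemma corner_sumE (n x y : nat) :
  corner_sum n.+1 x y =
  \sum_(1 <= a < x.+1) \sum_(1 <= b < n.+2) \sum_(y <= c < n.+2)
    count_abc n.+1 predT a b c.
Proof. by apply: eq_bigr => a _; rewrite exchange_big. Qed.

Lemma row_sum_diag (n a : nat) : 1 <= a <= n.+1 ->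
  row_sum n.+1 a a = corner_sum n a.-1 a.
Proof.
move=> an; rewrite /row_sum (bigD1_seq a) ?iota_uniq //=; last first.
  by rewrite mem_index_iota; lia.
rewrite big1 ?addn0 => [|b ba]; last first.
  by rewrite count_abc_eq0 //; apply/negP => /and4P[? ? ? ?]; lia.
case: n an => [|n] an; last first.
  by rewrite corner_sumE count_abc_singleton // prednK //; case/andP: an.
have -> : a = 1 by lia.
by rewrite count_abc_1.
Qed.

Lemma prefix_sum_diag (n a c : nat) : 1 <= a < c -> c <= n.+2 ->
  prefix_sum n.+2 a a c = corner_sum n (c - 2) a.
Proof.
move=> ac cn; rewrite /prefix_sum big_nat1.
case: n cn => [|n] cn; last first.
  rewrite corner_sumE count_abc_pair // (_ : (c - 2).+1 = c.-1) //.
  by lia.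
have -> : a = 1 by lia.
have -> : c = 2 by lia.
by rewrite count_abc_2.
Qed.

(** The last term of the prefix sum is, by the removal of [b], a prefix sum of the previous size.
    One addition thus replaces the inner sum of the recurrence. *)
Lemma prefix_sum_rec (n a b c : nat) : 1 <= a < b -> b < c <= n.+2 ->
  prefix_sum n.+2 a b c =
  prefix_sum n.+2 a b.-1 c + prefix_sum n.+1 a b.-1 c.-1.
Proof.
move=> ab bc; rewrite /prefix_sum big_nat_recr /=; last by lia.
rewrite prednK; last by lia.
by congr (_ + _); rewrite count_abc_remove.
Qed.

(** Terms with b < a or b >= c vanish, so the last prefix sum of a column is already the row sum and
    costs no further addition. *)
Lemma row_sum_prefix (n a c : nat) : 1 <= a < c -> c <= n ->
  row_sum n a c = prefix_sum n a c.-1 c.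
Proof.
move=> ac cn; rewrite /row_sum /prefix_sum prednK; last by lia.
rewrite (@big_cat_nat _ _ _ a) /=; [|lia|lia].
rewrite big_nat big1 ?add0n => [|b ba]; last first.
  by rewrite count_abc_eq0 //; apply/negP => /and4P[? ? ? ?]; lia.
rewrite (@big_cat_nat _ _ _ c) /=; [|lia|lia].
rewrite [X in _ + X]big_nat [X in _ + X]big1 ?addn0 // => b cb.
have [E|bc] := eqVneq b c; first by rewrite E count_abc_eq0_second //; lia.
by rewrite count_abc_eq0 //; apply/negP => /and4P[? ? ? ?]; lia.
Qed.

Lemma row_sum_eq0 (n a c : nat) : c < a -> row_sum n a c = 0.
Proof.
move=> ca; rewrite /row_sum big1 // => b _.
by rewrite count_abc_eq0 //; apply/negP => /and4P[? ? ? ?]; lia.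
Qed.

Lemma corner_sum0 (n y : nat) : corner_sum n.+1 0 y = 0.
Proof. by rewrite /corner_sum big_geq. Qed.

Lemma corner_sumS (n x y : nat) :
  corner_sum n.+1 x.+1 y =
  corner_sum n.+1 x y + \sum_(y <= c < n.+2) row_sum n.+1 x.+1 c.
Proof. by rewrite /corner_sum big_nat_recr. Qed.

Lemma corner_sum_geq (n x y : nat) : n.+1 < y -> corner_sum n.+1 x y = 0.
Proof.
by move=> ny; rewrite /corner_sum big1 // => a _; rewrite big_geq.
Qed.

Lemma corner_sum_popstacked (n : nat) : 1 <= n -> corner_sum n n 1 = popstacked n.
Proof.
case: n => [//|n] _; rewrite corner_sumE popstackedE.
rewrite (@sum_count_abc _ _ _ (fun a => index_iota 1 n.+2)
  (fun _ b => index_iota 1 n.+2)); do ?[exact: iota_uniq|move=> *; exact: iota_uniq].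
apply: eq_in_count => z zn; have z0 := permutations_iotaS_neq0 zn.
have [h1 h2 h3 h4] := last_run_bounds zn z0.
rewrite /= !mem_index_iota /overlapping z0 andbT.
set a := head _ _ in h1 h2 *; set b := second_last _ in h2 h3 *.
set c := last _ _ in h3 h4 *.
have -> : 0 < a < n.+2 by lia.
have -> : 0 < b < n.+2 by lia.
by have -> : 0 < c < n.+2 by lia.
Qed.

(** * Memory, time and access semantics of programs *)

Definition update (m : address -> nat) (l : address) (v : nat) : address -> nat :=
  fun l' => if l' == l then v else m l'.

Fixpoint exec_mem (p : prog) (env : seq int) (m : address -> nat) : address -> nat :=
  match p with
  | Assign x e => update m (locate env x) (eeval env m e)
  | Compose p1 p2 => exec_mem p2 env (exec_mem p1 env m)
  | For lo hi body =>
      foldl (fun m' i => exec_mem body (i :: env) m') m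
            (interval_seq (ieval env lo) (ieval env hi))
  end.

(** Loop bounds and positions do not depend on cell contents, so the time and the touched cells are
    functions of the environment alone and can be studied apart from the memory. *)
Fixpoint cost (p : prog) (env : seq int) : nat :=
  match p with
  | Assign x e => (additions e).+1
  | Compose p1 p2 => cost p1 env + cost p2 env
  | For lo hi body =>
      \sum_(i <- interval_seq (ieval env lo) (ieval env hi)) (cost body (i :: env)).+1
  end.

Fixpoint touches (p : prog) (env : seq int) (l : address) : bool :=
  match p with
  | Assign x e => l \in locate env x :: reads env e
  | Compose p1 p2 => touches p1 env l || touches p2 env l
  | For lo hi body =>
      has (fun i => touches body (i :: env) l)
          (interval_seq (ieval env lo) (ieval env hi))
  end.

Fixpoint written (p : prog) : seq nat :=
  match p with
  | Assign x e => [:: x.1]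
  | Compose p1 p2 => written p1 ++ written p2
  | For lo hi body => written body
  end.

Lemma mem_exec (p : prog) (env : seq int) (st : state) :
  Defs.mem (exec p env st) = exec_mem p env (Defs.mem st).
Proof.
elim: p env st => [x e|p1 IH1 p2 IH2|lo hi p IH] env st //=.
  by rewrite IH2 IH1.
by elim: interval_seq st => [//|i s IHs] st /=; rewrite IHs IH.
Qed.

Lemma clock_exec (p : prog) (env : seq int) (st : state) :
  clock (exec p env st) = clock st + cost p env.
Proof.
elim: p env st => [x e|p1 IH1 p2 IH2|lo hi p IH] env st //=.
  by rewrite IH2 IH1 addnA.
elim: interval_seq st => [|i s IHs] st /=; first by rewrite big_nil addn0.
by rewrite IHs IH big_cons /= addnA addSn addnS.
Qed.

Lemma accessed_exec (p : prog) (env : seq int) (st : state) (l : address) :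
  (l \in accessed (exec p env st)) = touches p env l || (l \in accessed st).
Proof.
elim: p env st => [x e|p1 IH1 p2 IH2|lo hi p IH] env st //=.
- by rewrite !inE mem_cat orbA.
- by rewrite IH2 IH1 orbA [_ || touches p1 _ _]orbC.
elim: interval_seq st => [//|i s IHs] st /=.
by rewrite IHs IH /= orbA [_ || touches p _ _]orbC.
Qed.

Lemma interval_seq_nat (l h : nat) :
  interval_seq (Posz l) (Posz h) = map Posz (index_iota l h.+1).
Proof.
rewrite /interval_seq /index_iota; case: ifP => lh.
  rewrite (_ : absz _ = h - l); last by lia.
  rewrite (_ : h.+1 - l = (h - l).+1); last by lia.
  have -> : iota l (h - l).+1 = map (addn l) (iota 0 (h - l).+1).
    by rewrite -iotaDl addn0.
  by rewrite -map_comp; apply: eq_map => k /=; rewrite PoszD.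
by rewrite (_ : h.+1 - l = 0) //; lia.
Qed.

(** Loop rule in which [I i] describes the memory before iteration [i]. The hypothesis [l <= h.+1]
    makes an empty loop start at [h.+1], where the conclusion is stated. *)
Lemma exec_mem_For (I : nat -> (address -> nat) -> Prop) (lo hi : iexpr)
    (body : prog) (env : seq int) (l h : nat) (m : address -> nat) :
  ieval env lo = Posz l -> ieval env hi = Posz h -> l <= h.+1 -> I l m ->
  (forall i m', l <= i <= h -> I i m' ->
     I i.+1 (exec_mem body (Posz i :: env) m')) ->
  I h.+1 (exec_mem (For lo hi body) env m).
Proof.
move=> /= -> -> lh Il step; rewrite interval_seq_nat.
have: forall k, k <= h.+1 - l ->
    I (l + k) (foldl (fun m' i => exec_mem body (i :: env) m') m
                     (map Posz (iota l k))).
  elim=> [|k IH] kh; first by rewrite addn0.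
  rewrite -addn1 iotaD map_cat foldl_cat /= addn1 addnS.
  by apply: step; [lia|apply: IH; lia].
by move/(_ (h.+1 - l) (leqnn _)); rewrite subnKC.
Qed.

Lemma exec_mem_frame (p : prog) (env : seq int) (m : address -> nat) (l : address) :
  l.1 \notin written p -> exec_mem p env m l = m l.
Proof.
elim: p env m => [x e|p1 IH1 p2 IH2|lo hi p IH] env m /=.
- rewrite inE /update => lx; case: eqP => // E; by rewrite E eqxx in lx.
- by rewrite mem_cat negb_or => /andP[l1 l2]; rewrite IH2 // IH1.
move=> lp; elim: interval_seq m => [//|i s IHs] m /=.
by rewrite IHs IH.
Qed.

Lemma cost_For (lo hi : iexpr) (body : prog) (env : seq int) (l h : nat) :
  ieval env lo = Posz l -> ieval env hi = Posz h ->
  cost (For lo hi body) env =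
  \sum_(l <= i < h.+1) (cost body (Posz i :: env)).+1.
Proof. by move=> /= -> ->; rewrite interval_seq_nat big_map. Qed.

Lemma touches_For (lo hi : iexpr) (body : prog) (env : seq int) (l h : nat)
    (x : address) :
  ieval env lo = Posz l -> ieval env hi = Posz h ->
  reflect (exists2 i, l <= i <= h & touches body (Posz i :: env) x)
          (touches (For lo hi body) env x).
Proof.
move=> /= -> ->; rewrite interval_seq_nat has_map.
apply: (iffP hasP) => [[i]|[i lih t]]; last by exists i => //; rewrite mem_index_iota ltnS.
by rewrite mem_index_iota ltnS => lih t; exists i.
Qed.

Lemma address2_eq (k k' : nat) (x x' y y' : int) :
  ((k, [:: x; y]) == (k', [:: x'; y']) :> address) = [&& k == k', x == x' & y == y'].
Proof. by rewrite xpair_eqE !eqseq_cons andbT. Qed.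

Lemma address3_eq (k k' : nat) (x x' y y' z z' : int) :
  ((k, [:: x; y; z]) == (k', [:: x'; y'; z']) :> address) =
  [&& k == k', x == x', y == y' & z == z'].
Proof. by rewrite xpair_eqE !eqseq_cons andbT. Qed.

(* While layer N is computed, array 1 holds prefix_sum N A B C, or
   prefix_sum (N - 1) A B C for the rows A still to come, at [N - A; B; C] and
   [N - 1 - A; B; C]; array 2 holds corner_sum (N - 1), array 3 holds
   corner_sum (N - 2), array 4 holds row_sum N, and array 5 the tail sums of its
   rows.  Loop indices are nested as N, A, C, B (innermost last), or as N, x, y
   for the two-dimensional arrays. *)
Definition extend_run : prog :=
  For (Iadd (Ivar 1) (Icst 1)) (Isub (Ivar 0) (Icst 1))
    (Assign (1, [:: Isub (Ivar 3) (Ivar 2); Ivar 0; Ivar 1])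
      (Eadd
        (Eread (1, [:: Isub (Ivar 3) (Ivar 2); Isub (Ivar 0) (Icst 1); Ivar 1]))
        (Eread (1, [:: Isub (Isub (Ivar 3) (Ivar 2)) (Icst 1);
                       Isub (Ivar 0) (Icst 1); Isub (Ivar 1) (Icst 1)])))).

Definition fill_column : prog :=
  Compose
    (Assign (1, [:: Isub (Ivar 2) (Ivar 1); Ivar 1; Ivar 0])
      (Eread (3, [:: Isub (Ivar 0) (Icst 2); Ivar 1])))
    (Compose extend_run
      (Assign (4, [:: Ivar 1; Ivar 0])
        (Eread (1, [:: Isub (Ivar 2) (Ivar 1); Isub (Ivar 0) (Icst 1); Ivar 0])))).

Definition fill_plane : prog :=
  Compose
    (Assign (4, [:: Ivar 0; Ivar 0])
      (Eread (2, [:: Isub (Ivar 0) (Icst 1); Ivar 0])))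
    (For (Iadd (Ivar 0) (Icst 1)) (Ivar 1) fill_column).

Definition save_corners : prog :=
  For (Icst 0) (Ivar 0) (For (Icst 1) (Ivar 1)
    (Assign (3, [:: Ivar 1; Ivar 0]) (Eread (2, [:: Ivar 1; Ivar 0])))).

(* The loop index counts y downwards from N. *)
Definition add_corner : prog :=
  let y := Isub (Iadd (Ivar 2) (Icst 1)) (Ivar 0) in
  Compose
    (Assign (5, [:: Ivar 1; y])
      (Eadd (Eread (5, [:: Ivar 1; Iadd y (Icst 1)])) (Eread (4, [:: Ivar 1; y]))))
    (Assign (2, [:: Ivar 1; y])
      (Eadd (Eread (2, [:: Isub (Ivar 1) (Icst 1); y])) (Eread (5, [:: Ivar 1; y])))).

Definition update_corners : prog :=
  For (Icst 1) (Ivar 0) (For (Icst 1) (Ivar 1) add_corner).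

(** Corner sums are saved before the update because last runs with two letters reach back two sizes.
    The assignment of 0 then clears the artificial value for size 0, already copied, which would
    spoil the zero border x = 0. *)
Definition layer : prog :=
  Compose (For (Icst 1) (Ivar 0) fill_plane)
    (Compose save_corners
      (Compose (Assign (2, [:: Icst 0; Icst 1]) (Ecst 0)) update_corners)).

Definition popstacked_prog : prog :=
  Compose (Assign (2, [:: Icst 0; Icst 1]) (Ecst 1))
    (Compose (For (Icst 1) (Ivar 0) layer)
      (Assign (0, [::]) (Eread (2, [:: Ivar 0; Icst 1])))).

(** * Correctness of the program *)

(** The clauses with value 0 describe cells that still hold their initial value. Later layers read
    the row entries below the diagonal and the tail entry just beyond the current size without
    initializing them, and 0 is the correct value there. *)
Record layer_done (M : nat) (m : address -> nat) : Prop := LayerDone {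
  done_prefix : forall A B C, 1 <= A <= B -> B < C <= M ->
    m (1, [:: (Posz M - Posz A)%R; Posz B; Posz C]) = prefix_sum M A B C;
  done_corner : forall x y, 1 <= y ->
    m (2, [:: Posz x; Posz y]) = if x <= M then corner_sum M x y else 0;
  done_saved : forall x y, x < M -> 1 <= y <= M ->
    m (3, [:: Posz x; Posz y]) = corner_sum M.-1 x y;
  done_row : forall x y, (y < x) || (M < y) -> m (4, [:: Posz x; Posz y]) = 0;
  done_tail : forall x y, M < y -> m (5, [:: Posz x; Posz y]) = 0 }.

Lemma updateE (m : address -> nat) (l l' : address) (v : nat) :
  update m l v l' = if l' == l then v else m l'.
Proof. by []. Qed.

Lemma exec_mem_Assign (x : cell) (t : expr) (env : seq int) (m : address -> nat) :
  exec_mem (Assign x t) env m = update m (locate env x) (eeval env m t).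
Proof. by []. Qed.

Lemma exec_mem_Compose (p q : prog) (env : seq int) (m : address -> nat) :
  exec_mem (Compose p q) env m = exec_mem q env (exec_mem p env m).
Proof. by []. Qed.

Arguments exec_mem : simpl never.

Section Layer.
Variables (M : nat) (e : seq int).

Section Plane.
Variables (A : nat) (m0 : address -> nat).
Hypotheses (A1 : 1 <= A <= M.+1)
  (old : forall B C, A <= B -> B < C <= M ->
     m0 (1, [:: (Posz M - Posz A)%R; Posz B; Posz C]) = prefix_sum M A B C)
  (saved : forall x y, x < M -> 1 <= y <= M ->
     m0 (3, [:: Posz x; Posz y]) = corner_sum M.-1 x y).

Let d : int := (Posz M.+1 - Posz A)%R.

Lemma fill_column_correct (C : nat) (m : address -> nat) :
  A < C <= M.+1 ->
  (forall d' x y, d' <> d -> m (1, [:: d'; x; y]) = m0 (1, [:: d'; x; y])) ->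
  (forall x y, m (3, [:: x; y]) = m0 (3, [:: x; y])) ->
  let m' := exec_mem fill_column [:: Posz C, Posz A, Posz M.+1 & e] m in
  [/\ forall B, A <= B < C -> m' (1, [:: d; Posz B; Posz C]) = prefix_sum M.+1 A B C,
      forall d' x y, ~~ ((d' == d) && (y == Posz C)) ->
        m' (1, [:: d'; x; y]) = m (1, [:: d'; x; y]),
      m' (4, [:: Posz A; Posz C]) = row_sum M.+1 A C
    & forall x y, ~~ ((x == Posz A) && (y == Posz C)) ->
        m' (4, [:: x; y]) = m (4, [:: x; y])].
Proof.
move=> AC same1 same3.
have M1 : 0 < M by lia.
set env := [:: Posz C, Posz A, Posz M.+1 & e].
set ma := update m (1, [:: d; Posz A; Posz C]) (corner_sum M.-1 (C - 2) A).
have Ea : exec_mem (Assign (1, [:: Isub (Ivar 2) (Ivar 1); Ivar 1; Ivar 0])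
      (Eread (3, [:: Isub (Ivar 0) (Icst 2); Ivar 1]))) env m = ma.
  rewrite exec_mem_Assign /= /locate /= /ma -/d; congr (update _ _ _).
  rewrite (_ : (Posz C - 2)%R = Posz (C - 2)); last by lia.
  by rewrite same3 saved //; lia.
pose I (B : nat) (m1 : address -> nat) : Prop :=
  [/\ forall B', A <= B' < B ->
        m1 (1, [:: d; Posz B'; Posz C]) = prefix_sum M.+1 A B' C,
      forall d' x y, ~~ ((d' == d) && (y == Posz C)) ->
        m1 (1, [:: d'; x; y]) = m (1, [:: d'; x; y])
    & forall x y, m1 (4, [:: x; y]) = m (4, [:: x; y])].
have IC : I C (exec_mem extend_run env ma).
  have -> : C = C.-1.+1 by lia.
  rewrite /extend_run.
  apply: (@exec_mem_For I _ _ _ _ A.+1 C.-1) => //=; try lia.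
    split.
    - move=> B' AB; have -> : B' = A by lia.
      rewrite /ma updateE eqxx; case: (M) M1 AC => [//|M'] _ AC.
      by rewrite prefix_sum_diag //; lia.
    - move=> d' x y; rewrite /ma updateE address3_eq.
      by case: eqP => //= -> /negbTE ->; rewrite andbF.
    - by move=> x y; rewrite /ma updateE xpair_eqE.
  move=> B m1 AB [h1 h2 h3]; rewrite exec_mem_Assign /= /locate /= -/d.
  (* Plane [d - 1] is the one that holds row [A] of size [M]. *)
  rewrite (_ : (d - 1)%R = (Posz M - Posz A)%R); last by rewrite /d; lia.
  rewrite (_ : (Posz B - 1)%R = Posz B.-1); last by lia.
  rewrite (_ : (Posz C - 1)%R = Posz C.-1); last by lia.
  split.
  - move=> B' AB'; rewrite updateE address3_eq !eqxx andbT /=.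
    case: eqP => [[->]|BB']; last by apply: h1; lia.
    rewrite h1; last by lia.
    rewrite h2; last by rewrite negb_and; apply/orP; left; apply/eqP; rewrite /d; lia.
    rewrite same1; last by rewrite /d; lia.
    rewrite old; [|lia|lia].
    case: (M) M1 AC => [//|M'] _ AC.
    by rewrite [RHS]prefix_sum_rec //; lia.
  - move=> d' x y dy; rewrite updateE address3_eq h2 //.
    by case: eqP dy => //= -> /negbTE ->; rewrite andbF.
  - by move=> x y; rewrite updateE xpair_eqE /= h3.
rewrite /fill_column !exec_mem_Compose Ea.
move: (exec_mem extend_run env ma) IC => mb [h1 h2 h3].
rewrite exec_mem_Assign /= /locate /= -/d.
rewrite (_ : (Posz C - 1)%R = Posz C.-1); last by lia.
split.
- by move=> B AB; rewrite updateE xpair_eqE /= h1.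
- by move=> d' x y dy; rewrite updateE xpair_eqE /= h2.
- by rewrite updateE eqxx h1 ?row_sum_prefix //; lia.
by move=> x y xy; rewrite updateE address2_eq /= (negbTE xy) h3.
Qed.

Lemma fill_plane_correct :
  m0 (2, [:: Posz A.-1; Posz A]) = corner_sum M A.-1 A ->
  let m' := exec_mem fill_plane [:: Posz A, Posz M.+1 & e] m0 in
  [/\ forall B C, A <= B -> B < C <= M.+1 ->
        m' (1, [:: d; Posz B; Posz C]) = prefix_sum M.+1 A B C,
      forall d' x y, d' <> d -> m' (1, [:: d'; x; y]) = m0 (1, [:: d'; x; y]),
      forall C, A <= C <= M.+1 -> m' (4, [:: Posz A; Posz C]) = row_sum M.+1 A C
    & forall x y, ~~ ((x == A) && (A <= y <= M.+1)) ->
        m' (4, [:: Posz x; Posz y]) = m0 (4, [:: Posz x; Posz y])].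
Proof.
move=> corner.
pose I (C : nat) (m : address -> nat) : Prop :=
  [/\ forall B C', A <= B -> B < C' < C ->
        m (1, [:: d; Posz B; Posz C']) = prefix_sum M.+1 A B C',
      forall d' x y, d' <> d -> m (1, [:: d'; x; y]) = m0 (1, [:: d'; x; y]),
      forall C', A <= C' < C -> m (4, [:: Posz A; Posz C']) = row_sum M.+1 A C',
      forall x y, ~~ ((x == A) && (A <= y < C)) ->
        m (4, [:: Posz x; Posz y]) = m0 (4, [:: Posz x; Posz y])
    & forall x y, m (3, [:: x; y]) = m0 (3, [:: x; y])].
suff: I M.+2 (exec_mem fill_plane [:: Posz A, Posz M.+1 & e] m0) by case.
rewrite /fill_plane exec_mem_Compose exec_mem_Assign /locate [map _ _]/= [eeval _ _ _]/= /locate [map _ _]/=.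
rewrite (_ : (Posz A - 1)%R = Posz A.-1); last by lia.
rewrite corner; apply: (@exec_mem_For I _ _ _ _ A.+1 M.+1) => //=; try lia.
  split.
  - by move=> B C' AB BC; lia.
  - by move=> d' x y dd; rewrite updateE xpair_eqE.
  - move=> C' AC; have -> : C' = A by lia.
    by rewrite updateE eqxx row_sum_diag.
  - move=> x y xy; rewrite updateE address2_eq /=.
    case: ifP => // /andP[/eqP[E1] /eqP[E2]]; move: xy.
    by rewrite E1 E2 eqxx leqnn ltnSn.
  - by move=> x y; rewrite updateE xpair_eqE.
move=> C m AC [k1 k2 k3 k4 k5].
have [h1 h2 h3 h4] := fill_column_correct AC k2 k5.
split.
- move=> B C' AB BC; have [E|CC] := eqVneq C' C.
    by subst C'; apply: h1; lia.
  rewrite h2; last by rewrite eqxx /=; apply: contra CC => /eqP[->].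
  by apply: k1 => //; lia.
- by move=> d' x y dd; rewrite h2 ?k2 //; apply/nandP; left; apply/eqP.
- move=> C' AC'; have [->//|CC] := eqVneq C' C.
  rewrite h4; last by rewrite eqxx /=; apply: contra CC => /eqP[->].
  by apply: k3; lia.
- move=> x y xy; rewrite h4; last first.
    by apply: contra xy => /andP[/eqP[->] /eqP[->]]; rewrite eqxx /=; lia.
  by apply: k4; apply: contra xy => /andP[->] /=; lia.
- by move=> x y; rewrite exec_mem_frame.
Qed.
End Plane.

(** The order of increasing A is essential: row A of size M+1 overwrites row A-1 of size M, which is
    no longer read, while row A of size M lies in the next lower plane and is intact until row A+1
    is written. The second clause of the invariant records the rows of size M still available. *)
Lemma fill_planes_correct (m : address -> nat) : layer_done M m ->
  let m' := exec_mem (For (Icst 1) (Ivar 0) fill_plane) [:: Posz M.+1 & e] m in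
  [/\ forall A B C, 1 <= A <= B -> B < C <= M.+1 ->
        m' (1, [:: (Posz M.+1 - Posz A)%R; Posz B; Posz C]) = prefix_sum M.+1 A B C,
      forall A C, 1 <= A -> A <= C <= M.+1 ->
        m' (4, [:: Posz A; Posz C]) = row_sum M.+1 A C
    & forall x y, (y < x) || (M.+1 < y) -> m' (4, [:: Posz x; Posz y]) = 0].
Proof.
move=> J.
pose I (A : nat) (m1 : address -> nat) : Prop :=
  [/\ forall A' B C, 1 <= A' < A -> A' <= B -> B < C <= M.+1 ->
        m1 (1, [:: (Posz M.+1 - Posz A')%R; Posz B; Posz C]) = prefix_sum M.+1 A' B C,
      forall A' B C, A <= A' -> A' <= B -> B < C <= M ->
        m1 (1, [:: (Posz M - Posz A')%R; Posz B; Posz C]) = prefix_sum M A' B C,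
      forall A' C, 1 <= A' < A -> A' <= C <= M.+1 ->
        m1 (4, [:: Posz A'; Posz C]) = row_sum M.+1 A' C,
      forall x y, (y < x) || (M.+1 < y) -> m1 (4, [:: Posz x; Posz y]) = 0
    & forall l, l.1 \notin [:: 1; 4] -> m1 l = m l].
suff [h1 _ h3 h4 _] : I M.+2 (exec_mem (For (Icst 1) (Ivar 0) fill_plane) [:: Posz M.+1 & e] m).
  split=> // [A B C AB BC|A C A1 AC]; [apply: h1|apply: h3]; lia.
apply: (@exec_mem_For I _ _ _ _ 1 M.+1) => //=.
  split=> // [A' B C ? ?|A' B C ? ? ?|A' C ? ?|x y xy]; try lia.
    by rewrite (done_prefix J) //; lia.
  by rewrite (done_row J) //; lia.
move=> A m1 A1 [i1 i2 i3 i4 i5].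
have saved x y : x < M -> 1 <= y <= M -> m1 (3, [:: Posz x; Posz y]) = corner_sum M.-1 x y.
  by move=> xM yM; rewrite i5 // (done_saved J).
have corner : m1 (2, [:: Posz A.-1; Posz A]) = corner_sum M A.-1 A.
  have AM : A.-1 <= M by lia.
  by rewrite i5 // (done_corner J) ?AM //; case/andP: A1.
have [h1 h2 h3 h4] := fill_plane_correct A1 (fun B C => i2 A B C (leqnn A)) saved corner.
split.
- move=> A' B C A'A AB BC; have [E|ne] := eqVneq A' A; first by subst A'; apply: h1.
  by rewrite h2 ?i1 //; lia.
- by move=> A' B C AA' AB BC; rewrite h2 ?i2 //; lia.
- move=> A' C A'A AC; have [E|ne] := eqVneq A' A; first by subst A'; apply: h3.
  rewrite h4 ?i3 //; last by rewrite (negbTE ne).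
  by lia.
- move=> x y xy; rewrite h4 ?i4 //.
  by apply/negP => /andP[/eqP E yA]; move: xy; rewrite E; lia.
- by move=> l l1; rewrite exec_mem_frame ?i5 //; apply: contra l1; rewrite /= !inE; case: (l.1 == 4); case: (l.1 == 1).
Qed.

Lemma save_corners_correct (m : address -> nat) (x y : nat) :
  x <= M -> 1 <= y <= M ->
  exec_mem save_corners [:: Posz M & e] m (3, [:: Posz x; Posz y]) =
  m (2, [:: Posz x; Posz y]).
Proof.
move=> xM yM.
pose same2 (m1 : address -> nat) := forall l, l.1 = 2 -> m1 l = m l.
pose I (X : nat) (m1 : address -> nat) : Prop :=
  same2 m1 /\ (x < X -> m1 (3, [:: Posz x; Posz y]) = m (2, [:: Posz x; Posz y])).
suff [_] : I M.+1 (exec_mem save_corners [:: Posz M & e] m) by apply.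
apply: (@exec_mem_For I _ _ _ _ 0 M) => //=.
move=> X m1 XM [s1 i1].
pose I' (Y : nat) (m2 : address -> nat) : Prop :=
  same2 m2 /\ ((x < X) || ((x == X) && (y < Y)) ->
     m2 (3, [:: Posz x; Posz y]) = m (2, [:: Posz x; Posz y])).
have [s2 i2] : I' M.+1 (exec_mem (For (Icst 1) (Ivar 1)
    (Assign (3, [:: Ivar 1; Ivar 0]) (Eread (2, [:: Ivar 1; Ivar 0]))))
    [:: Posz X, Posz M & e] m1).
  apply: (@exec_mem_For I' _ _ _ _ 1 M) => //=.
    by split=> // xX; apply: i1; lia.
  move=> Y m2 YM [s2 i2]; rewrite exec_mem_Assign /= /locate /=; split.
    by move=> [k l] /= kE; rewrite updateE xpair_eqE kE /= s2.
  move=> xX; rewrite updateE address2_eq /=.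
  case: ifP => [/andP[/eqP[->] /eqP[->]]|ne]; first by rewrite s2.
  apply: i2; case/orP: xX => [->//|/andP[/eqP xE yY]]; rewrite xE eqxx /= in ne *.
  by apply/orP; right; move/negbT: ne => /eqP ne; lia.
by split=> // xX; apply: i2; lia.
Qed.
End Layer.

(** Tail sums along a row, added row after row, give all corner sums with two additions per
    entry. *)
Lemma update_corners_correct (M : nat) (e : seq int) (m : address -> nat) :
  (forall x y, 1 <= x -> 1 <= y <= M.+1 ->
     m (4, [:: Posz x; Posz y]) = row_sum M.+1 x y) ->
  (forall x y, M.+1 < y -> m (5, [:: Posz x; Posz y]) = 0) ->
  (forall y, 1 <= y -> m (2, [:: Posz 0; Posz y]) = 0) ->
  let m' := exec_mem update_corners [:: Posz M.+1 & e] m in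
  [/\ forall x y, x <= M.+1 -> 1 <= y <= M.+1 ->
        m' (2, [:: Posz x; Posz y]) = corner_sum M.+1 x y,
      forall x y, ~~ ((x <= M.+1) && (1 <= y <= M.+1)) ->
        m' (2, [:: Posz x; Posz y]) = m (2, [:: Posz x; Posz y])
    & forall x y, M.+1 < y -> m' (5, [:: Posz x; Posz y]) = 0].
Proof.
move=> rows tails corner0.
pose I (X : nat) (m1 : address -> nat) : Prop :=
  [/\ forall x y, x < X -> 1 <= y <= M.+1 ->
        m1 (2, [:: Posz x; Posz y]) = corner_sum M.+1 x y,
      forall x y, ~~ ((x < X) && (1 <= y <= M.+1)) ->
        m1 (2, [:: Posz x; Posz y]) = m (2, [:: Posz x; Posz y]),
      forall x y, M.+1 < y -> m1 (5, [:: Posz x; Posz y]) = 0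
    & forall l, l.1 = 4 -> m1 l = m l].
suff: I M.+2 (exec_mem update_corners [:: Posz M.+1 & e] m) by case.
apply: (@exec_mem_For I _ _ _ _ 1 M.+1) => //=.
  split=> // [x y]; rewrite ltnS leqn0 => /eqP -> /andP[y1 _].
  by rewrite corner_sum0 corner0.
move=> X m1 XM [i1 i2 i3 i4].
(* Iteration [j] treats y = M+2-j. For j = 1 the invariant already contains the empty tail at y =
   M+2. *)
pose I' (j : nat) (m2 : address -> nat) : Prop :=
  [/\ forall y, M.+2 - j < y <= M.+2 ->
        m2 (5, [:: Posz X; Posz y]) = \sum_(y <= c < M.+2) row_sum M.+1 X c,
      forall y, M.+2 - j < y <= M.+1 ->
        m2 (2, [:: Posz X; Posz y]) = corner_sum M.+1 X y,
      forall x y, ~~ ((x == X) && (M.+2 - j < y <= M.+1)) ->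
        m2 (2, [:: Posz x; Posz y]) = m1 (2, [:: Posz x; Posz y]),
      forall x y, M.+1 < y -> m2 (5, [:: Posz x; Posz y]) = 0
    & forall l, l.1 = 4 -> m2 l = m l].
have [j1 j2 j3 j4 j5] : I' M.+2 (exec_mem (For (Icst 1) (Ivar 1) add_corner)
    [:: Posz X, Posz M.+1 & e] m1).
  apply: (@exec_mem_For I' _ _ _ _ 1 M.+1) => //=.
    split=> // y yM; last by lia.
    by rewrite i3 ?big_geq //; lia.
  move=> j m2 jM [j1 j2 j3 j4 j5].
  rewrite /add_corner exec_mem_Compose !exec_mem_Assign /= /locate /=.
  have [y yE] : exists y, y = M.+2 - j by exists (M.+2 - j).
  rewrite (_ : (Posz M.+1 + 1 - Posz j)%R = Posz y); last by lia.
  rewrite (_ : (Posz y + 1)%R = Posz y.+1); last by lia.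
  rewrite (_ : (Posz X - 1)%R = Posz X.-1); last by lia.
  rewrite !updateE !xpair_eqE !eqxx /=.
  have y1 : 1 <= y <= M.+1 by lia.
  rewrite j1; last by lia.
  rewrite [m2 (4, _)]j5 // rows //; last by lia.
  have -> : \sum_(y.+1 <= c < M.+2) row_sum M.+1 X c + row_sum M.+1 X y =
            \sum_(y <= c < M.+2) row_sum M.+1 X c.
    by rewrite addnC [RHS]big_ltn //; lia.
  rewrite j3; last by apply/negP => /andP[/eqP]; lia.
  rewrite i1 //; last by lia.
  have -> : corner_sum M.+1 X.-1 y + \sum_(y <= c < M.+2) row_sum M.+1 X c =
            corner_sum M.+1 X y.
    by rewrite -[in RHS](prednK (_ : 0 < X)) ?corner_sumS ?prednK //; lia.
  split.
  - move=> y' y'M; rewrite !updateE xpair_eqE /= address2_eq !eqxx /=.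
    by case: eqP => [[->]//|ne]; apply: j1; lia.
  - move=> y' y'M; rewrite !updateE address2_eq !eqxx /=.
    by case: eqP => [[->]//|ne]; apply: j2; lia.
  - move=> x y' xy; rewrite !updateE address2_eq /=.
    case: ifP => [/andP[/eqP[E1] /eqP[E2]]|_].
      by case/negP: xy; rewrite E1 E2 eqxx /=; lia.
    apply: j3; apply: contra xy => /andP[->] /=; lia.
  - move=> x y' My; rewrite !updateE xpair_eqE /= address2_eq /=.
    case: ifP => [/andP[_ /eqP[E]]|_]; [lia|exact: j4].
  - by move=> [k l] /= kE; rewrite !updateE !xpair_eqE kE /= j5.
split=> //.
- move=> x y xX yM; have [E|ne] := eqVneq x X; first by subst x; apply: j2; lia.
  by rewrite j3 ?(negbTE ne) // i1 //; lia.
- move=> x y xy; rewrite j3; last by apply: contra xy => /andP[/eqP-> yM]; lia.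
  by apply: i2; apply: contra xy => /andP[xX ->]; rewrite ltnS (ltnW xX).
Qed.

Lemma layer_correct (M : nat) (e : seq int) (m : address -> nat) :
  layer_done M m -> layer_done M.+1 (exec_mem layer [:: Posz M.+1 & e] m).
Proof.
move=> J; rewrite /layer !exec_mem_Compose.
set m1 := exec_mem (For _ _ fill_plane) _ m.
have [pre row row0] : [/\ _, _ & _] := fill_planes_correct e J; rewrite -/m1 in pre row row0.
have saved x y : x <= M.+1 -> 1 <= y <= M.+1 ->
    exec_mem save_corners [:: Posz M.+1 & e] m1 (3, [:: Posz x; Posz y]) =
    m1 (2, [:: Posz x; Posz y]) by apply: save_corners_correct.
set m2 := exec_mem save_corners _ m1 in saved *.
set m3 := exec_mem (Assign _ _) _ m2.
have m1E l : l.1 \notin [:: 1; 4] -> m1 l = m l.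
  by move=> ll; apply: exec_mem_frame; apply: contra ll; rewrite /= !inE; case: (l.1 == 4); case: (l.1 == 1).
have m2E l : l.1 != 3 -> m2 l = m1 l.
  by move=> ll; apply: exec_mem_frame; rewrite /= inE.
have m3E x y : m3 (2, [:: Posz x; Posz y]) =
    if (x == 0) && (y == 1) then 0 else m (2, [:: Posz x; Posz y]).
  rewrite /m3 exec_mem_Assign /= updateE /locate /= address2_eq /=.
  by rewrite m2E // m1E.
have m3E' l : l.1 != 2 -> m3 l = m2 l.
  by move=> ll; apply: exec_mem_frame; rewrite /= inE.
have rows x y : 1 <= x -> 1 <= y <= M.+1 ->
    m3 (4, [:: Posz x; Posz y]) = row_sum M.+1 x y.
  move=> x1 yM; rewrite m3E' // m2E //.
  have [xy|yx] := leqP x y; first by apply: row => //; lia.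
  by rewrite row_sum_eq0 // row0 // yx.
have tails x y : M.+1 < y -> m3 (5, [:: Posz x; Posz y]) = 0.
  by move=> My; rewrite m3E' // m2E // m1E // (done_tail J) // ltnW.
have corner0 y : 1 <= y -> m3 (2, [:: Posz 0; Posz y]) = 0.
  move=> y1; rewrite m3E (done_corner J) //=; case: eqP => // y1'.
  case: (M) => [|M'] /=; last exact: corner_sum0.
  by case: eqP.
have [c1 c2 c3] := update_corners_correct e rows tails corner0.
have m4E l : l.1 \notin [:: 2; 5] ->
    exec_mem update_corners [:: Posz M.+1 & e] m3 l = m2 l.
  move=> ll; rewrite exec_mem_frame; last first.
    by apply: contra ll; rewrite /= !inE; case: (l.1 == 2); case: (l.1 == 5).
  by apply: m3E'; apply: contra ll => /eqP->.
split.
- by move=> A B C AB BC; rewrite m4E // m2E // pre.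
- move=> x y y1; have [xM|Mx] := leqP x M.+1.
    have [yM|My] := leqP y M.+1; first by apply: c1; rewrite ?y1.
    rewrite c2; last by rewrite !negb_and -!ltnNge My !orbT.
    rewrite corner_sum_geq // m3E (_ : y == 1 = false) ?andbF; last by lia.
    rewrite (done_corner J) //; case: ifP => // _.
    case: (M) My => [|M'] My /=; last by apply: corner_sum_geq; lia.
    by rewrite (_ : y == 1 = false) ?andbF //; lia.
  rewrite c2; last by rewrite negb_and -ltnNge Mx.
  rewrite m3E (_ : x == 0 = false) /=; last by lia.
  by rewrite (done_corner J) // leqNgt (ltnW Mx).
- move=> x y xM yM; rewrite m4E // saved //; last by lia.
  by rewrite m1E // (done_corner J) -1?ltnS ?xM //; case/andP: yM.
- by move=> x y xy; rewrite m4E // m2E // row0.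
- exact: c3.
Qed.

Lemma popstacked_prog_correct (n : nat) : 1 <= n ->
  output popstacked_prog n = popstacked n.
Proof.
move=> n1; rewrite /output /final_state mem_exec /popstacked_prog !exec_mem_Compose.
have J : layer_done n (exec_mem (For (Icst 1) (Ivar 0) layer) [:: Posz n]
    (exec_mem (Assign (2, [:: Icst 0; Icst 1]) (Ecst 1)) [:: Posz n] (fun=> 0))).
  apply: (@exec_mem_For (fun N => layer_done N.-1) _ _ _ _ 1 n) => //=.
    rewrite exec_mem_Assign; split=> //.
    - by move=> A B C AB BC; lia.
    move=> x y y1; rewrite updateE /locate /= address2_eq /= leqn0.
    rewrite -[Posz y == 1%R]/(y == 1) -[Posz x == 0%R]/(x == 0).
    by case: eqP => //= _; case: eqP.
  move=> N m N1; have -> : N = N.-1.+1 by lia.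
  exact: layer_correct.
rewrite exec_mem_Assign updateE eqxx /= /locate /=.
by rewrite (done_corner J) // leqnn corner_sum_popstacked.
Qed.

(** * Cost of the program *)

Lemma cost_Assign (x : cell) (t : expr) (env : seq int) :
  cost (Assign x t) env = (additions t).+1.
Proof. by []. Qed.

Lemma cost_Compose (p q : prog) (env : seq int) :
  cost (Compose p q) env = cost p env + cost q env.
Proof. by []. Qed.

Arguments cost : simpl never.

Lemma cost_For_const (lo hi : iexpr) (body : prog) (env : seq int) (l h k : nat) :
  ieval env lo = Posz l -> ieval env hi = Posz h ->
  (forall i, cost body (Posz i :: env) = k) ->
  cost (For lo hi body) env = (h.+1 - l) * k.+1.
Proof.
move=> El Eh Ek; rewrite (cost_For _ El Eh) -sum_nat_const_nat.
by apply: eq_bigr => i _; rewrite Ek.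
Qed.

Lemma cost_extend_run (N A C : nat) (e : seq int) : A < C ->
  cost extend_run [:: Posz C, Posz A, Posz N & e] = 3 * (C - A.+1).
Proof.
move=> AC; by rewrite (@cost_For_const _ _ _ _ A.+1 C.-1 2) //=; lia.
Qed.

Lemma cost_fill_plane (N A : nat) (e : seq int) : A <= N ->
  2 * cost fill_plane [:: Posz A, Posz N & e] = 2 + 3 * (N - A) * (N - A).+1.
Proof.
move=> AN.
(* A column takes C-A-1 updates of three units and two more assignments; its loop iteration
   completes this to 3 (C-A). *)
have -> : cost fill_plane [:: Posz A, Posz N & e] =
    1 + \sum_(A.+1 <= C < N.+1) 3 * (C - A).
  rewrite /fill_plane cost_Compose cost_Assign.
  rewrite (@cost_For _ _ _ _ A.+1 N) /=; [|lia|lia].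
  congr (_ + _); apply: eq_big_nat => C AC.
  by rewrite /fill_column !cost_Compose !cost_Assign cost_extend_run /=; lia.
rewrite mulnDr; congr (_ + _).
rewrite -(subnK AN) addnK addnC; elim: (N - A) => [|k IH].
  by rewrite addn0 big_geq ?muln0.
by rewrite addnS big_nat_recr /= ?mulnDr ?IH; lia.
Qed.

Lemma cost_layer (N : nat) (e : seq int) :
  2 * (cost layer [:: Posz N & e]).+1 = N ^ 3 + 14 * N ^ 2 + 11 * N + 6.
Proof.
rewrite /layer !cost_Compose cost_Assign /=.
have -> : cost save_corners [:: Posz N & e] = N.+1 * (N * 2).+1.
  apply: (@cost_For_const _ _ _ _ 0) => // x.
  by rewrite (@cost_For_const _ _ _ _ 1 N 1) // subn1.
have -> : cost update_corners [:: Posz N & e] = N * (N * 5).+1.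
  rewrite (@cost_For_const _ _ _ _ 1 N (N * 5)) ?subn1 // => x.
  by rewrite (@cost_For_const _ _ _ _ 1 N 4) // subn1.
rewrite (@cost_For _ _ _ _ 1 N) //.
have -> : 2 * (\sum_(1 <= A < N.+1) (cost fill_plane [:: Posz A, Posz N & e]).+1 +
    (N.+1 * (N * 2).+1 + (1 + N * (N * 5).+1))).+1 =
  \sum_(1 <= A < N.+1) (4 + 3 * (N - A) * (N - A).+1) + 2 * (N.+1 * (N * 2).+1 + (2 + N * (N * 5).+1)).
  rewrite -(addn1 (_ + _)) -!addnA mulnDr big_distrr /=; congr (_ + _); last by lia.
  by apply: eq_big_nat => A AN; rewrite mulnS cost_fill_plane; lia.
have -> : \sum_(1 <= A < N.+1) (4 + 3 * (N - A) * (N - A).+1) = 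
   4 * N + N.-1 * N * N.+1.
  rewrite big_nat_rev /= big_add1 /=.
  rewrite (eq_big_nat _ _ (F2 := fun i => 4 + 3 * i * i.+1)); last first.
    by move=> i iN; have -> : N - (1 + N.+1 - i.+2) = i by lia.
  elim: N => [|N IH]; first by rewrite big_geq.
  by rewrite big_nat_recr //= IH; case: N {IH} => [//|N] /=; ring.
by case: N => [//|N] /=; ring.
Qed.

(** Layer N costs N^3/2 to leading order, and the sum over N gives n^4/8. Multiplying by 24 clears
    all denominators. *)
Lemma time_cost_popstacked (n : nat) :
  24 * time_cost popstacked_prog n =
  3 * n ^ 4 + 62 * n ^ 3 + 153 * n ^ 2 + 166 * n + 48.
Proof.
rewrite /time_cost /final_state clock_exec add0n.
rewrite /popstacked_prog !cost_Compose !cost_Assign /=.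
rewrite (@cost_For _ _ _ _ 1 n) //.
have E : 24 * (\sum_(1 <= N < n.+1) (cost layer [:: Posz N; Posz n]).+1) =
    \sum_(1 <= N < n.+1) 12 * (N ^ 3 + 14 * N ^ 2 + 11 * N + 6).
  by rewrite big_distrr /=; apply: eq_bigr => N _; rewrite -(cost_layer N [:: Posz n]); lia.
rewrite !mulnDr E; elim: n {E} => [|n IH]; first by rewrite big_geq.
rewrite big_nat_recr //=; move: IH; set S := \sum_(1 <= i < n.+1) _; move=> IH.
have -> : 24 * 1 + (S + 12 * (n.+1 ^ 3 + 14 * n.+1 ^ 2 + 11 * n.+1 + 6) + 24 * 1)
  = (24 * 1 + (S + 24 * 1)) + 12 * (n.+1 ^ 3 + 14 * n.+1 ^ 2 + 11 * n.+1 + 6) by lia.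
by rewrite IH; ring.
Qed.

(** * Cells used by the program *)

(** From A <= B < C <= N follows C-B <= N-A = d. Sorting by s = C-B leaves n-s choices each for d
    and B, so the size is a sum of squares, n^3/3 to leading order. *)
Definition prefix_cells (n : nat) : seq address :=
  [seq (1, [:: Posz x.1; Posz x.2; Posz (x.2 + s)])
     | s <- iota 1 n.-1, x <- [seq (d, B) | d <- iota s (n - s), B <- iota 1 (n - s)]].

Definition corner_cells (n : nat) : seq address :=
  (0, [::]) :: [seq (k, [:: Posz x.1; Posz x.2])
     | k <- iota 2 4, x <- [seq (x, y) | x <- iota 0 n.+1, y <- iota 0 n.+2]].

Lemma mem_prefix_cells (n d B C : nat) :
  1 <= B < C -> C <= n -> C - B <= d < n ->
  (1, [:: Posz d; Posz B; Posz C]) \in prefix_cells n.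
Proof.
move=> BC Cn dn; apply/allpairsPdep; exists (C - B), (d, B); split.
- by rewrite mem_iota; lia.
- by apply/allpairsP; exists (d, B); split; rewrite // mem_iota /=; lia.
by rewrite /= subnKC //; lia.
Qed.

Lemma prefix_cellsP (n : nat) (l : address) : l \in prefix_cells n ->
  exists d B C, [/\ 1 <= B < C, C <= n, C - B <= d < n
    & l = (1, [:: Posz d; Posz B; Posz C])].
Proof.
case/allpairsPdep => s [x [hs /allpairsP[[d B] [hd hB ->]] ->]].
exists d, B, (B + s); rewrite !mem_iota /= in hs hd hB *.
by split=> //; lia.
Qed.

Lemma mem_corner_cells (n k x y : nat) :
  2 <= k <= 5 -> x <= n -> y <= n.+1 ->
  (k, [:: Posz x; Posz y]) \in corner_cells n.
Proof.
move=> kk xn yn; rewrite inE; apply/orP; right.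
apply/allpairsPdep; exists k, (x, y); split=> //; first by rewrite mem_iota; lia.
by apply/allpairsP; exists (x, y); split; rewrite // mem_iota /=; lia.
Qed.

Lemma prefix_cells_uniq (n : nat) : uniq (prefix_cells n).
Proof.
apply: allpairs_uniq_dep.
- exact: iota_uniq.
- move=> s _; apply: allpairs_uniq; rewrite ?iota_uniq //.
  by move=> [a b] [c d] _ _ /= [-> ->].
move=> [s [d B]] [s' [d' B']] _ _ /= [-> -> /eqP].
by rewrite eqn_add2l => /eqP ->.
Qed.

Lemma size_prefix_cells (n : nat) : 6 * size (prefix_cells n) + 3 * n ^ 2 = 2 * n ^ 3 + n.
Proof.
rewrite size_allpairs_dep sumnE big_map.
under eq_bigr => s _ do rewrite size_allpairs !size_iota.
have -> : \sum_(s <- iota 1 n.-1) (n - s) * (n - s) = \sum_(0 <= i < n) i * i.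
  case: n => [|n]; first by rewrite !big_nil.
  rewrite [RHS]big_ltn // add0n [RHS]big_nat_rev /= /index_iota subn1 /=.
  apply: eq_big_seq => i; rewrite mem_iota => hi.
  by have -> : 1 + n.+1 - i.+1 = n.+1 - i by lia.
elim: n => [|n IH]; first by rewrite big_geq.
by rewrite big_nat_recr //= mulnDr; move: IH; set S := \sum_(_ <= _ < _) _ => IH; lia.
Qed.

Lemma size_corner_cells (n : nat) : size (corner_cells n) = (4 * (n.+1 * n.+2)).+1.
Proof.
rewrite /corner_cells -cat1s size_cat add1n; congr S.
rewrite size_allpairs_dep sumnE big_map.
under eq_bigr => k _ do rewrite size_allpairs !size_iota.
by rewrite big_const_seq count_predT size_iota iter_addn_0 mulnC.
Qed.

Lemma touches_Assign (x : cell) (t : expr) (env : seq int) (l : address) :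
  touches (Assign x t) env l = (l == locate env x) || (l \in reads env t).
Proof. by rewrite /= inE. Qed.

Lemma touches_Compose (p q : prog) (env : seq int) (l : address) :
  touches (Compose p q) env l = touches p env l || touches q env l.
Proof. by []. Qed.

Arguments touches : simpl never.

Lemma touches_fill_column (n N A C : nat) (e : seq int) (l : address) :
  1 <= A < C -> C <= N <= n ->
  touches fill_column [:: Posz C, Posz A, Posz N & e] l ->
  l \in prefix_cells n ++ corner_cells n.
Proof.
move=> AC CN.
have EC1 : (Posz C - 1)%R = Posz C.-1 by lia.
have EC2 : (Posz C - 2)%R = Posz (C - 2) by lia.
have END : (Posz N - Posz A)%R = Posz (N - A) by lia.
rewrite mem_cat /fill_column !touches_Compose !touches_Assign.
case/orP => [|/orP[]].
- rewrite /= /locate /= inE EC2 END => /orP[] /eqP ->.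
    by rewrite mem_prefix_cells //; lia.
  by rewrite orbC mem_corner_cells //; lia.
- case/(@touches_For _ _ _ _ A.+1 C.-1) => [||B AB]; [by rewrite /=; lia|by rewrite /= EC1|].
  rewrite touches_Assign /= /locate /= !inE END.
  have -> : (Posz (N - A) - 1)%R = Posz (N - A).-1 by lia.
  have -> : (Posz B - 1)%R = Posz B.-1 by lia.
  by rewrite EC1 => /orP[|/orP[]] /eqP ->; rewrite mem_prefix_cells //; lia.
rewrite /= /locate /= inE EC1 END => /orP[] /eqP ->.
  by rewrite orbC mem_corner_cells //; lia.
by rewrite mem_prefix_cells //; lia.
Qed.

Lemma touches_layer (n N : nat) (e : seq int) (l : address) :
  1 <= N <= n -> touches layer [:: Posz N & e] l ->
  l \in prefix_cells n ++ corner_cells n.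
Proof.
move=> Nn; rewrite /layer !touches_Compose !touches_Assign.
case/or4P.
- case/(@touches_For _ _ _ _ 1 N) => // A AN.
  rewrite /fill_plane touches_Compose touches_Assign => /orP[|].
    rewrite /= /locate /= inE.
    have -> : (Posz A - 1)%R = Posz A.-1 by lia.
    by case/orP => /eqP ->; rewrite mem_cat orbC mem_corner_cells //; lia.
  case/(@touches_For _ _ _ _ A.+1 N) => [|//|C AC]; first by rewrite /=; lia.
  by apply: touches_fill_column; lia.
- case/(@touches_For _ _ _ _ 0 N) => // x xN.
  case/(@touches_For _ _ _ _ 1 N) => // y yN.
  rewrite touches_Assign /= /locate /= inE.
  by case/orP => /eqP ->; rewrite mem_cat orbC mem_corner_cells //; lia.
- rewrite orbF => /eqP ->; rewrite mem_cat orbC.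
  by rewrite (@mem_corner_cells n 2 0 1).
case/(@touches_For _ _ _ _ 1 N) => // x xN.
case/(@touches_For _ _ _ _ 1 N) => // j jN.
rewrite /add_corner touches_Compose !touches_Assign /= /locate /= !inE.
have [y yE] : exists y, y = N.+1 - j by exists (N.+1 - j).
have -> : (Posz N + 1 - Posz j)%R = Posz y by lia.
have -> : (Posz y + 1)%R = Posz y.+1 by lia.
have -> : (Posz x - 1)%R = Posz x.-1 by lia.
by case/orP => /or3P[] /eqP ->; rewrite mem_cat orbC mem_corner_cells //; lia.
Qed.

Lemma touches_popstacked_prog (n : nat) (l : address) :
  touches popstacked_prog [:: Posz n] l -> l \in prefix_cells n ++ corner_cells n.
Proof.
rewrite /popstacked_prog !touches_Compose !touches_Assign => /or3P[].
- rewrite orbF => /eqP ->; rewrite mem_cat orbC.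
  by rewrite (@mem_corner_cells n 2 0 1).
- by case/(@touches_For _ _ _ _ 1 n) => // N; apply: touches_layer.
rewrite /= /locate /= inE => /orP[] /eqP ->; rewrite mem_cat orbC.
  by rewrite /corner_cells mem_head.
by rewrite (@mem_corner_cells n 2 n 1).
Qed.

(** The memory estimate is an asymptotic equality, so every one of these cells must be shown to
    occur in the execution. *)
Lemma prefix_cells_touched (n : nat) (l : address) :
  l \in prefix_cells n -> touches popstacked_prog [:: Posz n] l.
Proof.
case/prefix_cellsP => d [B [C [BC Cn dn ->]]].
(* The cell is assigned for size N = d + A whenever A <= B and C <= N <= n; the witness is the least
   such A, the maximum of 1 and C-d. *)
have [A [A1 AB CdA dAn]] : exists A, [/\ 1 <= A, A <= B, C <= d + A & d + A <= n].
  by have [Cd|dC] := leqP C d.+1; [exists 1|exists (C - d)]; split; lia.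
rewrite /popstacked_prog !touches_Compose; apply/orP; right; apply/orP; left.
apply/(@touches_For _ _ _ _ 1 n) => //; exists (d + A); first by lia.
rewrite /layer touches_Compose; apply/orP; left.
apply/(@touches_For _ _ _ _ 1 (d + A)) => //; exists A; first by lia.
rewrite /fill_plane touches_Compose; apply/orP; right.
apply/(@touches_For _ _ _ _ A.+1 (d + A)) => //; first by rewrite /=; lia.
exists C; first by lia.
have Ed : (Posz (d + A) - Posz A)%R = Posz d by lia.
rewrite /fill_column touches_Compose.
move: AB; rewrite leq_eqVlt => /orP[/eqP AB|AB]; apply/orP; [left|right].
  by rewrite touches_Assign /locate /= Ed AB eqxx.
rewrite touches_Compose; apply/orP; left.
apply/(@touches_For _ _ _ _ A.+1 C.-1); [by rewrite /=; lia|by rewrite /=; lia|].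
by exists B; [lia|rewrite touches_Assign /locate /= Ed eqxx].
Qed.

Lemma memory_cost_popstacked (n : nat) :
  size (prefix_cells n) <= memory_cost popstacked_prog n
    <= size (prefix_cells n) + (4 * (n.+1 * n.+2)).+1.
Proof.
have E l : (l \in undup (accessed (final_state popstacked_prog n))) =
    touches popstacked_prog [:: Posz n] l.
  by rewrite mem_undup accessed_exec orbF.
apply/andP; split.
  apply: uniq_leq_size; first exact: prefix_cells_uniq.
  by move=> l /prefix_cells_touched; rewrite E.
rewrite -size_corner_cells -size_cat; apply: uniq_leq_size; first exact: undup_uniq.
by move=> l; rewrite E; apply: touches_popstacked_prog.
Qed.

(** * Asymptotics *)

Local Open Scope classical_set_scope.
Local Open Scope nat_scope.

(** An error of one degree less is absorbed as soon as n >= c a / eps. *)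
Lemma equiv_monomial (R : realType) (f : nat -> nat) (k : nat) (a c : R) :
  (0 < a)%R ->
  (forall n : nat, (0 < n)%N -> `|(f n)%:R - n%:R ^+ k.+1 / a| <= c * n%:R ^+ k)%R ->
  (fun n : nat => (f n)%:R%R : R^o)
    ~_ \oo (fun n : nat => (n%:R ^+ k.+1 / a)%R : R^o).
Proof.
move=> a0 fc; apply/eqaddoP => eps eps0.
near=> n.
have n0 : 0 < n by near: n; exists 1.
have nc : (c * a / eps <= n%:R)%R by near: n; exact: nbhs_infty_ger.
apply: le_trans (fc n n0) _.
rewrite normrM normfV (gtr0_norm a0) ger0_norm ?exprn_ge0 // exprSr.
have nk : (0 <= n%:R ^+ k :> R)%R by rewrite exprn_ge0.
have -> : (eps * (n%:R ^+ k * n%:R / a) = eps * (n%:R / a) * n%:R ^+ k)%R by ring.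
rewrite ler_wpM2r // mulrA ler_pdivlMr // [(eps * _)%R]mulrC.
by rewrite -ler_pdivrMr.
Unshelve. all: by end_near. Qed.

Lemma time_cost_equiv (R : realType) :
  (fun n : nat => (time_cost popstacked_prog n)%:R%R : R^o)
    ~_ \oo (fun n : nat => (n%:R ^+ 4 / 8%:R)%R : R^o).
Proof.
(* The lower coefficients add up to (62 + 153 + 166 + 48) / 24 < 18, and lower powers of n are at
   most n^3. *)
apply: (@equiv_monomial _ _ 3 8%:R%R 18%:R%R) => // n n0.
have : (24 * (time_cost popstacked_prog n)%:R = 3 * n%:R ^+ 4 + 62 * n%:R ^+ 3 +
    153 * n%:R ^+ 2 + 166 * n%:R + 48 :> R)%R.
  by rewrite -!natrX -!natrM -!natrD time_cost_popstacked.
have : (1 <= n%:R :> R)%R by rewrite ler1n.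
move: (n%:R)%R ((time_cost _ _)%:R)%R => x t x1 E.
have x2 : (x <= x ^+ 2)%R by rewrite expr2 ler_peMl //; lra.
have x3 : (x ^+ 2 <= x ^+ 3)%R by rewrite [(x ^+ 3)%R]exprS ler_peMl //; lra.
have -> : (t - x ^+ 4 / 8%:R =
    (62 * x ^+ 3 + 153 * x ^+ 2 + 166 * x + 48) / 24)%R by lra.
by rewrite ler_norml; apply/andP; split; lra.
Qed.

Lemma memory_cost_equiv (R : realType) :
  (fun n : nat => (memory_cost popstacked_prog n)%:R%R : R^o)
    ~_ \oo (fun n : nat => (n%:R ^+ 3 / 3%:R)%R : R^o).
Proof.
(* The quadratic arrays and the output take at most 4n^2 + 12n + 9 cells, which is at most 25 n^2;
   the lower terms of the cubic part are negative and smaller. *)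
apply: (@equiv_monomial _ _ 2 3%:R%R 25%:R%R) => // n n0.
have : (6 * (size (prefix_cells n))%:R + 3 * n%:R ^+ 2 = 2 * n%:R ^+ 3 + n%:R :> R)%R.
  by rewrite -!natrX -!natrM -!natrD size_prefix_cells.
have /andP[] := memory_cost_popstacked n; rewrite -!(ler_nat R).
have -> : ((size (prefix_cells n) + (4 * (n.+1 * n.+2)).+1)%:R =
    (size (prefix_cells n))%:R + (4 * n%:R ^+ 2 + 12 * n%:R + 9) :> R)%R.
  by rewrite -natrX -!natrM -!natrD; congr (_%:R)%R; lia.
have : (1 <= n%:R :> R)%R by rewrite ler1n.
move: (n%:R)%R ((memory_cost _ _)%:R)%R ((size _)%:R)%R => x m s x1 sm ms E.
have x2 : (x <= x ^+ 2)%R by rewrite expr2 ler_peMl //; lra.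
by rewrite ler_norml; apply/andP; split; lra.
Qed.

Theorem theorem11 :
  [/\ (* recurrence *)
      forall N K A B C : nat, 1 <= N -> 1 <= K ->
        1 <= A -> A <= B -> B <= C -> C <= N ->
        (N, K, A, B, C) <> (1, 1, 1, 1, 1) ->
        (N, K, A, B, C) <> (2, 1, 1, 1, 2) ->
        popstacked_abc N K A B C =
          ((A == B) && (B == C)) *
            (\sum_(1 <= a < (A - 1).+1) \sum_(1 <= b < (N - 1).+1)
               \sum_(A <= c < (N - 1).+1) popstacked_abc (N - 1) (K - 1) a b c)
        + ((A == B) && (B < C)) *
            (\sum_(1 <= a < (C - 2).+1) \sum_(1 <= b < (N - 2).+1)
               \sum_(A <= c < (N - 2).+1) popstacked_abc (N - 2) (K - 1) a b c)
        + ((A < B) && (B < C)) *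
            (\sum_(A <= b < (B - 1).+1) popstacked_abc (N - 1) K A b (C - 1)),
      (* initial conditions *)
      popstacked_abc 1 1 1 1 1 = 1 /\ popstacked_abc 2 1 1 1 2 = 1,
      forall n k : nat, 1 <= n ->
        popstacked_runs n k =
          \sum_(1 <= a < n.+1) \sum_(a <= b < n.+1) \sum_(b <= c < n.+1)
            popstacked_abc n k a b c,
      forall n : nat, 1 <= n ->
        popstacked n = \sum_(1 <= k < n.+1) popstacked_runs n k
    & (* complexity *)
      exists P : prog,
        (forall n : nat, 1 <= n -> output P n = popstacked n) /\
        (forall R : realType,
          ((fun n : nat => ((time_cost P n)%:R)%R : R^o)
             ~_ \oo (fun n : nat => ((n%:R) ^+ 4 / 8%:R)%R : R^o)) /\
          ((fun n : nat => ((memory_cost P n)%:R)%R : R^o)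
             ~_ \oo (fun n : nat => ((n%:R) ^+ 3 / 3%:R)%R : R^o)))].
Proof.
split.
- exact: popstacked_abc_recurrence.
- by rewrite !popstacked_abcE count_abc_1 count_abc_2.
- exact: popstacked_runs_sum.
- exact: popstacked_sum.
exists popstacked_prog; split; first exact: popstacked_prog_correct.
by move=> R; split; [exact: time_cost_equiv|exact: memory_cost_equiv].
Qed.
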